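(* Let $\Gamma\subseteq \mathrm{SL}_2(\mathbb R)$ be a commensurable subgroup, let $k\in\frac12\mathbb Z$, let $\nu$ be any consistent finite weight $k$ multiplier for $\Gamma$, and let $U$ be a set of cusps for $\Gamma$, with complement $\overline U$ in the set of all cusps of $\Gamma$. Let $(f^{(\nu)}_{k,U,m})_{m\in I^{(\nu)}_k(U)}$ and $(f^{(\overline\nu)}_{2-k,\overline U,n})_{n\in I^{(\overline\nu)}_{2-k}(\overline U)}$ be the row-reduced canonical bases of $M^{(\infty)}_k(\Gamma,\nu,U)$ and $M^{(\infty)}_{2-k}(\Gamma,\overline\nu,\overline U)$. Then their coefficients satisfy $$a^{(\nu)}_{k,U}(m,n)=-\,a^{(\overline\nu)}_{2-k,\overline U}(n,m)$$ for all $m\in I^{(\nu)}_k(U)$ and $n\in I^{(\overline\nu)}_{2-k}(\overline U)$.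
   Context: **Groups and multipliers.** $\mathbb H$ is the upper half-plane and $q^r=e^{2\pi i r z}$. A *commensurable subgroup* is a subgroup $\Gamma\subseteq \mathrm{SL}_2(\mathbb R)$ such that $\Gamma\cap \mathrm{SL}_2(\mathbb Z)$ has finite index in both $\Gamma$ and $\mathrm{SL}_2(\mathbb Z)$. Its cusps are the elements of $\Omega(\Gamma)=\Gamma\backslash(\mathbb Q\cup\{\infty\})$. For $\gamma=\begin{pmatrix}a&b\\c&d\end{pmatrix}\in \mathrm{GL}_2^+(\mathbb R)$ put $j(\gamma,z)=\det(\gamma)^{-1/2}(cz+d)$; for $k\in\frac12+\mathbb Z$, $j^k=(\sqrt j)^{2k}$ with the principal square root. Let $\mathfrak G_k$ be the group of pairs $(\gamma,\phi)$ with $\gamma=\begin{pmatrix}a&b\\c&d\end{pmatrix}\in \mathrm{GL}_2^+(\mathbb R)$ and $\phi$ holomorphic on $\mathbb H$ with $|\phi(z)|=\det(\gamma)^{-k/2}|cz+d|^k$, with product $(\gamma,\phi(z))(\mu,\psi(z))=(\gamma\mu,\phi(\mu z)\psi(z))$. A *consistent weight $k$ multiplier* for $\Gamma$ is a function $\nu:\Gamma\to\mathbb C^\times$ such that $\{(\gamma,\nu(\gamma)j(\gamma,z)^k):\gamma\in\Gamma\}$ is a subgroup of $\mathfrak G_k$ and $\nu(\gamma)j(\gamma,z)^k=1$ for all scalar $\gamma\in\Gamma$; it is *finite* if its image is finite. Then $\overline\nu$ is a consistent finite weight $2-k$ multiplier. A function $f$ is modular of weight $k$ for $(\Gamma,\nu)$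 if $f(\gamma z)=\nu(\gamma)j(\gamma,z)^kf(z)$ for all $\gamma\in\Gamma$. **Spaces.** $M_k^!(\Gamma,\nu)$: weight $k$ modular forms for $(\Gamma,\nu)$ holomorphic on $\mathbb H$ and meromorphic at all cusps. $M_k(\Gamma,\nu)$: those holomorphic at all cusps. For $U\subseteq\Omega(\Gamma)$, $M_k(\Gamma,\nu,U)$ is the space of $f\in M_k(\Gamma,\nu)$ vanishing at each cusp in $U$; $M^{(\infty)}_k(\Gamma,\nu,U)$ is the space of $f\in M^!_k(\Gamma,\nu)$ which are holomorphic at every cusp other than $\infty$ and vanish at each cusp in $U$ other than $\infty$. **Exponents.** The upper triangular elements of $\Gamma$ all have the form $\pm\begin{pmatrix}1&r\\0&1\end{pmatrix}$, and the set of occurring $r$ is $w\mathbb Z$ for a unique rational $w>0$. Let $\varsigma\in[0,1)$ be the rational number such that $f(z+w)=e^{2\pi i\varsigma}f(z)$ for every weight $k$ modular $f$ for $(\Gamma,\nu)$; that is, $e^{2\pi i\varsigma}=\nu(T)$ if $T=\begin{pmatrix}1&w\\0&1\end{pmatrix}\in\Gamma$, and $e^{2\pi i\varsigma}=\nu(T)i^{2k}$ with $T=\begin{pmatrix}-1&-w\\0&-1\end{pmatrix}\in\Gamma$ otherwise. Set $\mathbb Z^{(\nu)}=\{(n+\varsigma)/w:n\in\mathbb Z\}$, the set of exponents allowed in expansions at $\infty$; $\mathbb Z^{(\overline\nu)}=-\mathbb Z^{(\nu)}$ (weight $2-k$ for $\overline\nu$). **Index sets and bases.** Let $\widetilde I^{(\nu)}_k(U)\subseteq\mathbb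 Z^{(\nu)}_{\ge0}$ be the finite set of orders of vanishing at $\infty$ (leading exponents of $q$) of nonzero elements of $M_k(\Gamma,\nu,U)$. Define $I^{(\nu)}_k(U)$ by the disjoint union $$I^{(\nu)}_k(U)\sqcup\widetilde I^{(\overline\nu)}_{2-k}(\overline U)=Z\sqcup\bigl(-\widetilde I^{(\nu)}_k(U)\bigr),\qquad Z=\begin{cases}\mathbb Z^{(\overline\nu)}_{>0}&\text{if }\infty\notin U,\\ \mathbb Z^{(\overline\nu)}_{\ge0}&\text{if }\infty\in U.\end{cases}$$ The row-reduced canonical basis of $M^{(\infty)}_k(\Gamma,\nu,U)$ is the basis indexed by $I^{(\nu)}_k(U)$ whose $m$-th element is the unique element of that space of the form $$f^{(\nu)}_{k,U,m}(z)=q^{-m}+\sum_{n\in\mathbb Z^{(\nu)},\ -n\notin I^{(\nu)}_k(U)}a^{(\nu)}_{k,U}(m,n)q^n.$$ *)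

(* Defs.v *)
From HB Require Import structures.
From mathcomp Require Import all_boot all_order all_algebra.
From mathcomp Require Import complex.
From mathcomp Require Import all_classical all_reals all_analysis.

Set Implicit Arguments.
Unset Strict Implicit.
Unset Printing Implicit Defensive.

Import Order.TTheory GRing.Theory Num.Theory.
Import numFieldNormedType.Exports.

Local Open Scope classical_set_scope.
Local Open Scope ring_scope.
Local Open Scope complex_scope.

(* Conventions.
   - A weight k in (1/2)Z is represented by the integer kk = 2k; the dual weight
     2 - k is therefore 4 - kk.
   - A function on the upper half-plane is a function R[i] -> R[i] of which only
     the values on [upper_half] matter; equalities are only required there.
   - Exponents of q are real numbers. *)

Section ComplexFunctions.
Variable R : realType.

Definition upper_half : set R[i] := [set z | 0 < complex.Im z].

Definition holomorphic (f : R[i] -> R[i]) : Prop :=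
  forall z, upper_half z -> derivable (f : R[i]^o -> R[i]^o) z 1.

Definition cexp (z : R[i]) : R[i] :=
  (expR (complex.Re z))%:C * (cos (complex.Im z) +i* sin (complex.Im z)).

(* q^r = exp(2 pi i r z) *)
Definition qpow (r : R) (z : R[i]) : R[i] := cexp ((2 * pi * r)%:C * 'i%C * z).

End ComplexFunctions.

Arguments upper_half {R}.

Section Matrices.
Variable R : realType.
Implicit Types (g : 'M[R]_2) (z : R[i]).

Definition mx2 (a b c d : R) : 'M[R]_2 :=
  \matrix_(i < 2, j < 2)
    if i == 0 then (if j == 0 then a else b) else (if j == 0 then c else d).

Definition denom g z : R[i] := (g 1 0)%:C * z + (g 1 1)%:C.

Definition mobius g z : R[i] := ((g 0 0)%:C * z + (g 0 1)%:C) / denom g z.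

Definition autj g z : R[i] := ((Num.sqrt (\det g))^-1)%:C * denom g z.

(* [sqrtc] is the principal square root: Re >= 0, and sqrtc (-1) = 'i. *)
Definition autjk (kk : int) g z : R[i] := sqrtc (autj g z) ^ kk.

Definition SL2Z : set 'M[R]_2 :=
  [set g | \det g = 1 /\ forall i j, g i j \is a Num.int].

Definition subgroup_SL2R (G : set 'M[R]_2) : Prop :=
  [/\ G `<=` [set g | \det g = 1], G 1%:M,
      forall g h, G g -> G h -> G (g *m h)
    & forall g, G g -> G (invmx g)].

Definition finite_index (H G : set 'M[R]_2) : Prop :=
  finite_set [set [set g *m h | h in H] | g in G].

Definition commensurable (G : set 'M[R]_2) : Prop :=
  [/\ subgroup_SL2R G, finite_index (G `&` SL2Z) G
    & finite_index (G `&` SL2Z) SL2Z].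

(* The action on P^1(R); [None] is the point at infinity. *)
Definition mobius_P1 g (x : option R) : option R :=
  match x with
  | Some t => let d := g 1 0 * t + g 1 1 in
              if d == 0 then None else Some ((g 0 0 * t + g 0 1) / d)
  | None => if g 1 0 == 0 then None else Some (g 0 0 / g 1 0)
  end.

Definition P1Q : set (option R) :=
  [set x | if x is Some t then exists r : rat, t = ratr r else True].

Definition orbit_P1 (G : set 'M[R]_2) (x : option R) : set (option R) :=
  [set mobius_P1 g x | g in G].

Definition cusps (G : set 'M[R]_2) : set (set (option R)) :=
  [set orbit_P1 G x | x in P1Q].

Definition cusp_infty (G : set 'M[R]_2) : set (option R) := orbit_P1 G None.

End Matrices.

Arguments SL2Z {R}.
Arguments P1Q {R}.

Section Multipliers.
Variable R : realType.
Local Notation pairG := ('M[R]_2 * (R[i] -> R[i]))%type.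

(* The group of pairs (g, phi). *)
Definition in_Gk (kk : int) (x : pairG) : Prop :=
  [/\ 0 < \det x.1, holomorphic x.2
    & forall z, upper_half z ->
        ComplexField.Normc.normc (x.2 z) =
          (\det x.1) `^ (- (kk%:~R / 2) / 2) * (ComplexField.Normc.normc (denom x.1 z)) `^ (kk%:~R / 2)].

Definition Gk_mul (x y : pairG) : pairG :=
  (x.1 *m y.1, fun z => x.2 (mobius y.1 z) * y.2 z).

Definition Gk_one : pairG := (1%:M, fun=> 1).

Definition Gk_eq (x y : pairG) : Prop :=
  x.1 = y.1 /\ forall z, upper_half z -> x.2 z = y.2 z.

Definition subgroup_Gk (kk : int) (S : set pairG) : Prop :=
  [/\ forall x, S x -> in_Gk kk x,
      S Gk_one,
      forall x y, S x -> S y -> S (Gk_mul x y)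
    & forall x, S x -> exists y, [/\ S y, Gk_eq (Gk_mul x y) Gk_one
                                   & Gk_eq (Gk_mul y x) Gk_one]].

Definition multiplier_lift (G : set 'M[R]_2) (kk : int) (nu : 'M[R]_2 -> R[i]) :
    set pairG :=
  [set x | G x.1 /\ forall z, upper_half z -> x.2 z = nu x.1 * autjk kk x.1 z].

Definition consistent_multiplier (G : set 'M[R]_2) (kk : int)
    (nu : 'M[R]_2 -> R[i]) : Prop :=
  [/\ forall g, G g -> nu g != 0,
      subgroup_Gk kk (multiplier_lift G kk nu)
    & forall g, G g -> is_scalar_mx g ->
        forall z, upper_half z -> nu g * autjk kk g z = 1].

Definition finite_multiplier (G : set 'M[R]_2) (nu : 'M[R]_2 -> R[i]) : Prop :=
  finite_set [set nu g | g in G].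

Definition conj_mult (nu : 'M[R]_2 -> R[i]) : 'M[R]_2 -> R[i] :=
  fun g => (nu g)^*.

End Multipliers.

Section ModularForms.
Variable R : realType.
Implicit Types (G : set 'M[R]_2) (kk : int) (nu : 'M[R]_2 -> R[i]).
Implicit Types (U : set (set (option R))) (f : R[i] -> R[i]).

Definition modular G kk nu f : Prop :=
  forall g z, G g -> upper_half z ->
    f (mobius g z) = nu g * autjk kk g z * f z.

Definition slash kk f (g : 'M[R]_2) : R[i] -> R[i] :=
  fun z => (autjk kk g z)^-1 * f (mobius g z).

(* f has an expansion \sum_(n >= n0) a_n q^(n/N) for some N > 0.  Since the
   multipliers are finite and the groups commensurable with SL2(Z), some N
   accommodates the expansion of a modular form at any given cusp. *)
Definition qexp_from (n0 : int) f : Prop :=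
  exists N : nat, (0 < N)%N /\ exists a : nat -> R[i],
    forall z, upper_half z ->
      series (fun n : nat => a n * qpow ((n0 + n%:Z)%:~R / N%:R) z) @ \oo --> (f z : R[i]^o).

Definition qmeromorphic f : Prop := exists n0, qexp_from n0 f.
Definition qholomorphic f : Prop := qexp_from 0 f.
Definition qvanishing f : Prop := qexp_from 1 f.

(* The condition P at i\infty, transported to the cusp c (an orbit in P^1(Q)). *)
Definition at_cusp (P : (R[i] -> R[i]) -> Prop) kk f (c : set (option R)) : Prop :=
  forall g, SL2Z g -> c (mobius_P1 g None) -> P (slash kk f g).

Definition weakly_holomorphic G kk nu f : Prop :=
  [/\ modular G kk nu f, holomorphic f
    & forall c, cusps G c -> at_cusp qmeromorphic kk f c].

Definition modular_forms G kk nu f : Prop :=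
  weakly_holomorphic G kk nu f /\
  forall c, cusps G c -> at_cusp qholomorphic kk f c.

Definition modular_forms_vanishing G kk nu U f : Prop :=
  modular_forms G kk nu f /\ forall c, U c -> at_cusp qvanishing kk f c.

Definition modular_forms_pole_infty G kk nu U f : Prop :=
  [/\ weakly_holomorphic G kk nu f,
      forall c, cusps G c -> c <> cusp_infty G -> at_cusp qholomorphic kk f c
    & forall c, U c -> c <> cusp_infty G -> at_cusp qvanishing kk f c].

Definition is_width G (w : R) : Prop :=
  0 < w /\ forall r : R,
    (G (mx2 1 r 0 1) \/ G (- mx2 1 r 0 1)) <-> exists n : int, r = n%:~R * w.

Definition is_shift G kk nu (w s : R) : Prop :=
  [/\ 0 <= s < 1,
      G (mx2 1 w 0 1) -> cexp ((2 * pi * s)%:C * 'i%C) = nu (mx2 1 w 0 1)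
    & ~ G (mx2 1 w 0 1) ->
        cexp ((2 * pi * s)%:C * 'i%C) = nu (- mx2 1 w 0 1) * 'i%C ^ kk].

Definition exponents G kk nu : set R :=
  [set x | exists w s, [/\ is_width G w, is_shift G kk nu w s
                         & exists n : int, x = (n%:~R + s) / w]].

(* f = \sum_(n in exponents) a(n) q^n, with finitely many negative exponents. *)
Definition expansion_infty G kk nu f (a : R -> R[i]) : Prop :=
  (forall x, ~ exponents G kk nu x -> a x = 0) /\
  exists w s, [/\ is_width G w, is_shift G kk nu w s &
    exists n0 : int,
      (forall n : int, n < n0 -> a ((n%:~R + s) / w) = 0) /\
      forall z, upper_half z ->
        series (fun n : nat => let x := ((n0 + n%:Z)%:~R + s) / w in a x * qpow x z)
          @ \oo --> (f z : R[i]^o)].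

Definition has_order G kk nu f (r : R) : Prop :=
  exists a, [/\ expansion_infty G kk nu f a, a r != 0
              & forall x, x < r -> a x = 0].

Definition order_set G kk nu U : set R :=
  [set r | exists f, [/\ modular_forms_vanishing G kk nu U f,
                         exists z, upper_half z /\ f z != 0
                       & has_order G kk nu f r]].

Definition cocusps G U : set (set (option R)) := cusps G `\` U.

Definition gap_set G kk nu U : set R :=
  [set x | exponents G (4 - kk) (conj_mult nu) x /\
           ((U (cusp_infty G) -> 0 <= x) /\ (~ U (cusp_infty G) -> 0 < x))].

(* The set I determined by the disjoint union  I + I~' = Z + (- I~),  where
   I~ and I~' are the sets of orders in weights k and 2 - k. *)
Definition index_set G kk nu U : set R :=
  (gap_set G kk nu U `|` [set - r | r in order_set G kk nu U])
    `\` order_set G (4 - kk) (conj_mult nu) (cocusps G U).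

(* f = q^(-m) + \sum_(n in exponents, - n notin I) a(n) q^n *)
Definition row_reduced G kk nu U (m : R) f (a : R -> R[i]) : Prop :=
  (forall n, ~ (exponents G kk nu n /\ ~ index_set G kk nu U (- n)) -> a n = 0) /\
  expansion_infty G kk nu f (fun n => (n == - m)%:R + a n).

(* (f m), for m in I, is the row-reduced canonical basis, and a m n is the
   coefficient of q^n in f m for n \in exponents with - n \notin I. *)
Definition canonical_basis G kk nu U (f : R -> R[i] -> R[i])
    (a : R -> R -> R[i]) : Prop :=
  [/\ forall m, index_set G kk nu U m ->
        modular_forms_pole_infty G kk nu U (f m) /\
        row_reduced G kk nu U m (f m) (a m),
      forall m h b, index_set G kk nu U m ->
        modular_forms_pole_infty G kk nu U h -> row_reduced G kk nu U m h b ->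
        forall z, upper_half z -> h z = f m z,
      forall (s : seq R) (c : R -> R[i]), uniq s ->
        (forall m, m \in s -> index_set G kk nu U m) ->
        (forall z, upper_half z -> \sum_(m <- s) c m * f m z = 0) ->
        forall m, m \in s -> c m = 0
    & forall h, modular_forms_pole_infty G kk nu U h ->
        exists (s : seq R) (c : R -> R[i]),
          (forall m, m \in s -> index_set G kk nu U m) /\
          forall z, upper_half z -> h z = \sum_(m <- s) c m * f m z].

End ModularForms.

(* Main.v *)
Require Import Defs.
From mathcomp Require Import all_boot all_order all_algebra.
From mathcomp Require Import complex.
From mathcomp Require Import all_classical all_reals all_analysis.
From mathcomp Require Import ring lra.

(** The grid relation is the residue theorem applied to a product.  Let [f] be
    the [m]-th basis element in weight [k] and [g] the [n]-th one in weight
    [2 - k].  The multipliers have modulus [1], so they cancel in [F = f g], and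
    [F(z) dz] is invariant under the group.  At each cusp other than infinity one
    factor vanishes and the other is holomorphic, so the constant term of [F]
    vanishes there.  At infinity the constant term is the sum of [A x * B (- x)]
    over the exponents [x] of the two expansions.  By definition of the index
    sets, and because orders of vanishing are nonnegative and are positive at a
    cusp where vanishing is imposed, every exponent [x] has [- x] in the index
    set of weight [k] or [x] in that of weight [2 - k], and no [x] has both
    properties ([index_sets_cover], [index_sets_disjoint]).  Row reduction thus
    leaves only the exponents [- m] and [n], and the constant term is
    [b n m + a m n].  The residue theorem ([residue_infinity_eq0]) says that it
    is zero.

    The residue theorem is obtained without integration.  A function on the upper
    half-plane has mean [c] if it has a primitive [Phi] such that
    [Phi (z + t) - c t] stays bounded for real [t]; for a q-series this [c] is the
    constant coefficient, and the primitive is found by integrating termwise.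
    A product of two q-series is handled by using termwise integration twice, once
    for [q^x g] and once for the sum of the [a_n q^(x_n) g] ([mean_bound_series],
    [mean_qseriesM]).  Given a form [F] of weight two for the group, the sum of its
    translates over the cosets of the intersection with the modular group is of
    weight two and level one.  In level one the mean vanishes: the primitive is
    changed by a constant under each of [z |-> -1/z] and [z |-> z + 1], and fixed
    points show that both constants are zero ([level_one_mean_eq0]).  A translate
    of [F] by an element that moves infinity out of its orbit has mean zero, and
    any other translate is, up to the group, [F] composed with an affine map, so
    that its mean is a positive multiple of that of [F].  A sum of such multiples,
    at least one of them positive, is zero only if the mean of [F] is. *)

Set Implicit Arguments.
Unset Strict Implicit.
Unset Printing Implicit Defensive.

Import Order.TTheory GRing.Theory Num.Theory.
Import numFieldNormedType.Exports.

Local Open Scope classical_set_scope.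
Local Open Scope ring_scope.
Local Open Scope complex_scope.

(** * The modulus, limits and derivatives in the complex plane *)

Local Notation nc := (@ComplexField.Normc.normc _).

Section ComplexCalculus.
Variable R : realType.
Local Notation C := R[i].
Implicit Types (z w h l : C) (f g F : C -> C).

Lemma ncD z w : nc (z + w) <= nc z + nc w.
Proof. exact: (@le_normcD R z w). Qed.

Lemma ncM z w : nc (z * w) = nc z * nc w.
Proof. exact: ComplexField.Normc.normcM. Qed.

Lemma ncN z : nc (- z) = nc z.
Proof. exact: (@normcN R z). Qed.

Lemma nc0 : nc (0 : C) = 0.
Proof. exact: ComplexField.Normc.normc0. Qed.

Lemma nc1 : nc (1 : C) = 1.
Proof. exact: ComplexField.Normc.normc1. Qed.

Lemma nc_ge0 z : 0 <= nc z.
Proof. by case: z => a b; exact: sqrtr_ge0. Qed.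

Lemma nc_real (x : R) : nc x%:C = `|x|.
Proof. by rewrite /= expr0n addr0 sqrtr_sqr. Qed.

Lemma ncB z w : nc (z - w) = nc (w - z).
Proof. by rewrite -opprB ncN. Qed.

Lemma nc_eq0 z : (nc z == 0) = (z == 0).
Proof.
apply/eqP/eqP => [|->]; last exact: nc0.
exact: ComplexField.Normc.eq0_normc.
Qed.

Lemma nc_gt0 z : (0 < nc z) = (z != 0).
Proof. by rewrite lt_neqAle nc_ge0 andbT eq_sym nc_eq0. Qed.

Lemma ncV z : nc z^-1 = (nc z)^-1.
Proof. exact: ComplexField.Normc.normcV. Qed.

Lemma normC_nc z : `|z| = (nc z)%:C.
Proof. by rewrite normc_def; case: z. Qed.

Lemma Re_le_nc z : `|complex.Re z| <= nc z.
Proof.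
case: z => a b /=; rewrite -sqrtr_sqr ler_wsqrtr // lerDl; exact: sqr_ge0.
Qed.

Lemma Im_le_nc z : `|complex.Im z| <= nc z.
Proof.
case: z => a b /=; rewrite -sqrtr_sqr ler_wsqrtr // lerDr; exact: sqr_ge0.
Qed.

Lemma nc_imag (x : R) : nc ('i%C * x%:C : C) = `|x|.
Proof. by rewrite /= -sqrtr_sqr; congr Num.sqrt; ring. Qed.

Lemma nc_le_ReIm z : nc z <= `|complex.Re z| + `|complex.Im z|.
Proof. by rewrite {1}(complexE z); apply: le_trans (ncD _ _) _; rewrite nc_real nc_imag. Qed.

Lemma nc_sum (I : Type) (s : seq I) (P : pred I) (f : I -> C) :
  nc (\sum_(i <- s | P i) f i) <= \sum_(i <- s | P i) nc (f i).
Proof.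
elim/big_rec2: _ => [|i y x _ le_xy]; first by rewrite nc0.
by apply: le_trans (ncD _ _) _; rewrite lerD2l.
Qed.

Lemma Re_sum (I : Type) (s : seq I) (P : pred I) (f : I -> C) :
  complex.Re (\sum_(i <- s | P i) f i) = \sum_(i <- s | P i) complex.Re (f i).
Proof. by elim/big_rec2: _ => [|i y [a b] _ <-] //=; case: (f i). Qed.

Lemma Im_sum (I : Type) (s : seq I) (P : pred I) (f : I -> C) :
  complex.Im (\sum_(i <- s | P i) f i) = \sum_(i <- s | P i) complex.Im (f i).
Proof. by elim/big_rec2: _ => [|i y [a b] _ <-] //=; case: (f i). Qed.

Definition clim (u : nat -> C) (l : C) : Prop :=
  forall e : R, 0 < e -> exists N, forall n, (N <= n)%N -> nc (u n - l) <= e.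

Lemma clim_cvg (u : nat -> C) (l : C) :
  (u @ \oo --> (l : R[i]^o)) -> clim u l.
Proof.
move=> /(@cvgrPdist_le R[i] R[i]^o nat \oo _ u l).1 ul e e0.
have /ul[N _ hN] : 0 < e%:C by rewrite ltcR.
exists N => n Nn; have /= := hN n Nn.
by rewrite normC_nc lecR ncB.
Qed.

Lemma clim_le u l (b : R) N :
  clim u l -> (forall n, (N <= n)%N -> nc (u n) <= b) -> nc l <= b.
Proof.
move=> ul ub; apply/ler_addgt0Pr => e e0.
have [M hM] := ul e e0; set n := maxn N M.
have := ncD (u n) (l - u n); rewrite addrC subrK ncB => /le_trans; apply.
by apply: lerD; [apply: ub; exact: leq_maxl | apply: hM; exact: leq_maxr].
Qed.

Lemma climD u v l m : clim u l -> clim v m -> clim (fun n => u n + v n) (l + m).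
Proof.
move=> ul vm e e0; have e2 : 0 < e / 2 by rewrite divr_gt0.
have [N hN] := ul _ e2; have [M hM] := vm _ e2.
exists (maxn N M) => n; rewrite geq_max => /andP[Nn Mn].
rewrite opprD addrACA (splitr e); apply: le_trans (ncD _ _) _.
by apply: lerD; [exact: hN | exact: hM].
Qed.

Lemma climZ a u l : clim u l -> clim (fun n => a * u n) (a * l).
Proof.
move=> ul e e0; have a1 : 0 < nc a + 1 by rewrite ltr_wpDl ?nc_ge0.
have [N hN] := ul _ (divr_gt0 e0 a1).
exists N => n Nn; rewrite -mulrBr ncM.
apply: le_trans (_ : (nc a + 1) * (e / (nc a + 1)) <= _); last first.
  by rewrite mulrC divfK ?gt_eqF.
by apply: ler_pM; rewrite ?nc_ge0 ?lerDl ?hN.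
Qed.

Lemma clim_cst l : clim (fun=> l) l.
Proof. by move=> e e0; exists 0%N => n _; rewrite subrr nc0 ltW. Qed.

Lemma clim_ext u v l N : (forall n, (N <= n)%N -> u n = v n) -> clim u l -> clim v l.
Proof.
move=> uv ul e e0; have [M hM] := ul e e0; exists (maxn N M) => n.
by rewrite geq_max => /andP[Nn Mn]; rewrite -uv // hM.
Qed.

Lemma clim_uniq u l m : clim u l -> clim u m -> l = m.
Proof.
move=> ul um; apply/eqP; rewrite -subr_eq0 -nc_eq0 eq_le nc_ge0 andbT.
have := climD ul (climZ (-1) um); rewrite mulN1r => h.
apply: (clim_le (N := 0%N) h) => n _.
by rewrite mulN1r subrr nc0.
Qed.

(** Domination by a convergent real series gives convergence in [C] through
    the real and imaginary parts. *)
Lemma clim_series_exists (u : nat -> C) (b : nat -> R) :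
  (forall n, nc (u n) <= b n) -> cvgn (series b) -> exists l, clim (series u) l.
Proof.
move=> ub cb.
have b0 n : 0 <= b n by apply: le_trans (ub n); exact: nc_ge0.
have aux (p : C -> R) : (forall z, `|p z| <= nc z) -> cvgn (series (p \o u)).
  move=> hp; apply: normed_cvg; apply: series_le_cvg cb => // n; rewrite /= ?normr_ge0 //.
  by apply: le_trans (hp _) (ub n).
have /cvg_ex[/= x hx] := aux _ Re_le_nc.
have /cvg_ex[/= y hy] := aux _ Im_le_nc.
exists (x +i* y) => e e0; have e2 : 0 < e / 2 by rewrite divr_gt0.
move/cvgrPdist_le : hx => /(_ _ e2)[N _ hN].
move/cvgrPdist_le : hy => /(_ _ e2)[M _ hM].
exists (maxn N M) => n; rewrite geq_max => /andP[Nn Mn].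
apply: le_trans (nc_le_ReIm _) _; rewrite (splitr e).
have := hN n Nn; have := hM n Mn; rewrite /= /series /= => h1 h2.
have -> : complex.Re (\sum_(0 <= k < n) u k - (x +i* y))
          = - (x - \sum_(0 <= k < n) complex.Re (u k)).
  by rewrite -Re_sum opprB; case: (\sum_(0 <= k < n) u k).
have -> : complex.Im (\sum_(0 <= k < n) u k - (x +i* y))
          = - (y - \sum_(0 <= k < n) complex.Im (u k)).
  by rewrite -Im_sum opprB; case: (\sum_(0 <= k < n) u k).
by rewrite !normrN lerD.
Qed.

(** The complex derivative.  The remainder is measured by the real-valued modulus
    rather than by the norm of [C], whose values are complex numbers, so that
    real estimates apply directly. *)
Definition cderiv f z l : Prop :=
  forall e : R, 0 < e -> exists2 d : R, 0 < d &
    forall h, nc h <= d -> nc (f (z + h) - f z - l * h) <= e * nc h.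

Lemma cderiv_cst c z : cderiv (fun=> c) z 0.
Proof.
move=> e e0; exists 1 => // h _.
by rewrite subrr mul0r subr0 nc0 mulr_ge0 ?nc_ge0 // ltW.
Qed.

Lemma cderiv_id z : cderiv id z 1.
Proof.
move=> e e0; exists 1 => // h _.
rewrite (_ : _ - _ = 0); first by rewrite nc0 mulr_ge0 ?nc_ge0 // ltW.
by rewrite /=; ring.
Qed.

Lemma cderivD f g z l m :
  cderiv f z l -> cderiv g z m -> cderiv (fun w => f w + g w) z (l + m).
Proof.
move=> df dg e e0; have e2 : 0 < e / 2 by rewrite divr_gt0.
have [d d0 hd] := df _ e2; have [d' d0' hd'] := dg _ e2.
exists (Num.min d d'); first by rewrite lt_min d0.
move=> h; rewrite le_min => /andP[/hd h1 /hd' h2].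
rewrite (_ : _ - _ = (f (z + h) - f z - l * h) + (g (z + h) - g z - m * h)); last by ring.
apply: le_trans (ncD _ _) _; rewrite (splitr e) mulrDl; exact: lerD.
Qed.

Lemma cderivZ a f z l : cderiv f z l -> cderiv (fun w => a * f w) z (a * l).
Proof.
move=> df e e0; have a1 : 0 < nc a + 1 by rewrite ltr_wpDl ?nc_ge0.
have [d d0 hd] := df _ (divr_gt0 e0 a1).
exists d => // h /hd hh.
rewrite (_ : _ - _ = a * (f (z + h) - f z - l * h)); last by ring.
rewrite ncM; apply: le_trans (_ : (nc a + 1) * (e / (nc a + 1) * nc h) <= _); last first.
  by rewrite mulrA [_ * (e / _)]mulrC divfK ?gt_eqF.
by apply: ler_pM; rewrite ?nc_ge0 ?lerDl.
Qed.

Lemma cderiv_sum (I : Type) (s : seq I) (f : I -> C -> C) (l : I -> C) z :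
  (forall i, cderiv (f i) z (l i)) ->
  cderiv (fun w => \sum_(i <- s) f i w) z (\sum_(i <- s) l i).
Proof.
move=> df; elim: s => [|i s IH].
  rewrite big_nil (_ : (fun _ => _) = fun=> 0); first exact: cderiv_cst.
  by apply/funext => w; rewrite big_nil.
rewrite big_cons (_ : (fun _ => _) = fun w => f i w + \sum_(i <- s) f i w).
  exact: cderivD.
by apply/funext => w; rewrite big_cons.
Qed.

Lemma cderiv_lip f z l : cderiv f z l -> exists2 d : R, 0 < d &
  forall h, nc h <= d -> nc (f (z + h) - f z) <= (nc l + 1) * nc h.
Proof.
move=> /(_ 1 ltr01)[d d0 hd]; exists d => // h /hd hh.
rewrite -[f (z + h) - f z](subrK (l * h)); apply: le_trans (ncD _ _) _.
by rewrite ncM mulrDl addrC lerD2l.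
Qed.

Lemma cderiv_comp f g z l m :
  cderiv g z m -> cderiv f (g z) l -> cderiv (fun w => f (g w)) z (l * m).
Proof.
move=> dg df e e0.
have m1 : 0 < nc m + 1 by rewrite ltr_wpDl ?nc_ge0.
have l1 : 0 < nc l + 1 by rewrite ltr_wpDl ?nc_ge0.
have [d1 d10 h1] := df _ (divr_gt0 (divr_gt0 e0 (ltr0Sn R 1)) m1).
have [d2 d20 h2] := cderiv_lip dg.
have [d3 d30 h3] := dg _ (divr_gt0 (divr_gt0 e0 (ltr0Sn R 1)) l1).
exists (Num.min (d1 / (nc m + 1)) (Num.min d2 d3)).
  by rewrite !lt_min d20 d30 divr_gt0.
move=> h; rewrite !le_min => /andP[hd1 /andP[/h2 hd2 /h3 hd3]].
set k := g (z + h) - g z in hd2 hd3.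
have gk : g (z + h) = g z + k by rewrite /k [RHS]addrC subrK.
have kd : nc k <= d1.
  by apply: le_trans hd2 _; rewrite mulrC -ler_pdivlMr.
rewrite gk (_ : _ - _ = (f (g z + k) - f (g z) - l * k) + l * (k - m * h)); last by ring.
apply: le_trans (ncD _ _) _; rewrite (splitr e) mulrDl; apply: lerD.
  apply: le_trans (h1 k kd) _.
  apply: le_trans (_ : e / 2 / (nc m + 1) * ((nc m + 1) * nc h) <= _).
    by rewrite ler_wpM2l // ltW // !divr_gt0.
  by rewrite mulrA divfK ?gt_eqF.
rewrite ncM; apply: le_trans (_ : (nc l + 1) * (e / 2 / (nc l + 1) * nc h) <= _).
  by apply: ler_pM; rewrite ?nc_ge0 ?lerDl.
by rewrite mulrA [_ * (e / 2 / _)]mulrC divfK ?gt_eqF.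
Qed.

End ComplexCalculus.

Section MeanValue.
Variable R : realType.
Local Notation C := R[i].

(** This translation lets the real mean value theorem apply to functions that
    are differentiable in the sense of [cderiv]. *)
Lemma is_derive_epsP (f : R -> R) (x l : R) :
  is_derive x 1 f l <->
  (forall e : R, 0 < e -> exists2 d : R, 0 < d &
    forall h : R, `|h| <= d -> `|f (x + h) - f x - l * h| <= e * `|h|).
Proof.
have quotE (h : R) : h != 0 ->
    `|l - h^-1 *: (f (h *: (1 : R) + x) - f x)| * `|h| = `|f (x + h) - f x - l * h|.
  move=> h0; rewrite -normrM mulrBl /GRing.scale /= mulr1 [h + x]addrC mulrAC mulVf // mul1r.
  by rewrite -normrN opprB.
split=> [[df dfl] e e0|H].
  have cf : (fun h : R => h^-1 *: (f (h *: (1 : R) + x) - f x)) @ 0^' --> (l : R).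
    by rewrite -dfl; exact: df.
  move/cvgrPdist_le : cf => /(_ e e0) => -[d /= d0 hd].
  exists (d / 2); first by rewrite divr_gt0.
  move=> h hh; have [->|h0] := eqVneq h 0.
    by rewrite addr0 mulr0 subrr subr0 normr0 mulr0.
  rewrite -quotE // ler_wpM2r //; apply: hd => //=.
  by rewrite sub0r normrN; apply: le_lt_trans hh _; rewrite ltr_pdivrMr // ltr_pMr // ltr1n.
have cf : (fun h : R => h^-1 *: (f (h *: (1 : R) + x) - f x)) @ 0^' --> (l : R).
  apply/cvgrPdist_le => e e0; have [d d0 hd] := H e e0.
  exists d => //= h; rewrite /= sub0r normrN => hh h0.
  have h1 : 0 < `|h| by rewrite normr_gt0.
  by rewrite -(ler_pM2r h1) quotE // hd // ltW.
split; last exact: cvg_lim.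
by apply/cvg_ex; exists l.
Qed.

Lemma unit_interval_mean_value (f df : R -> R) (M : R) :
  (forall t, t \in `[(0 : R), 1] -> is_derive t 1 f (df t)) ->
  (forall t, t \in `[(0 : R), 1] -> `|df t| <= M) -> `|f 1 - f 0| <= M.
Proof.
move=> fdf dfM.
have [c c01] : exists2 c, c \in `](0 : R), 1[ & f 1 - f 0 = df c * (1 - 0).
  apply (@MVT R f df 0 1 ltr01).
  - by move=> t t01; apply: fdf; exact: subset_itv_oo_cc.
  - by apply: derivable_within_continuous => t /fdf[].
by rewrite subr0 mulr1 => ->; apply: dfM; exact: subset_itv_oo_cc.
Qed.

Implicit Types (z w : C) (Phi F : C -> C).

Lemma derive_segment (p : C -> R) Phi z k l (t : R) :
  (forall u v, p (u - v) = p u - p v) -> (forall (r : R) u, p (r%:C * u) = r * p u) ->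
  (forall u, `|p u| <= nc u) ->
  cderiv Phi (z + t%:C * k) l ->
  is_derive t 1 (fun s : R => p (Phi (z + s%:C * k))) (p (l * k)).
Proof.
move=> pB pZ pn dPhi; apply/is_derive_epsP => e e0.
have k1 : 0 < nc k + 1 by rewrite ltr_wpDl ?nc_ge0.
have [d d0 hd] := dPhi _ (divr_gt0 e0 k1).
exists (d / (nc k + 1)); first by rewrite divr_gt0.
move=> h hh.
have hk : nc (h%:C * k) <= d.
  rewrite ncM nc_real -(@divfK _ (nc k + 1) _ d) ?gt_eqF //.
  by rewrite ler_pM ?nc_ge0 // lerDl.
have -> : z + (t + h)%:C * k = z + t%:C * k + h%:C * k by rewrite rmorphD /=; ring.
rewrite [_ * h]mulrC -pZ -!pB; apply: le_trans (pn _) _.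
rewrite mulrCA; apply: le_trans (hd _ hk) _.
rewrite ncM nc_real mulrCA [leRHS]mulrC ler_wpM2l // mulrAC ler_pdivrMr //.
by rewrite ler_wpM2l // ?ltW // ltrDl.
Qed.

(** The mean value theorem is applied to the real and the imaginary part of
    [Phi] along the segment separately, whence the factor [2]. *)
Lemma mean_value_le Phi F z w (M : R) :
  (forall t, 0 <= t <= 1 -> cderiv Phi (z + t%:C * (w - z)) (F (z + t%:C * (w - z))) /\
                          nc (F (z + t%:C * (w - z))) <= M) ->
  nc (Phi w - Phi z) <= 2 * M * nc (w - z).
Proof.
move=> H; set k := w - z in H *.
have aux (p : C -> R) : (forall u v, p (u - v) = p u - p v) ->
    (forall (r : R) u, p (r%:C * u) = r * p u) -> (forall u, `|p u| <= nc u) ->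
    `|p (Phi w - Phi z)| <= M * nc k.
  move=> pB pZ pn; pose f s := p (Phi (z + s%:C * k)).
  have df t : t \in `[(0 : R), 1] ->
      is_derive t 1 f (p (F (z + t%:C * k) * k)).
    by rewrite in_itv => /H[+ _]; exact: derive_segment.
  have := unit_interval_mean_value df.
  rewrite /f -!pB rmorph1 rmorph0 mul1r mul0r addr0 /k [z + _]addrC subrK; apply.
  move=> t; rewrite in_itv => /H[_ Fc].
  by apply: le_trans (pn _) _; rewrite ncM ler_wpM2r ?nc_ge0.
apply: le_trans (nc_le_ReIm _) _; rewrite -mulrA mulr_natl mulr2n; apply: lerD.
  apply: (aux (@complex.Re R)) (@Re_le_nc R) => [[a b] [c d]|r [a b]] //=.
  by rewrite mul0r subr0.
apply: (aux (@complex.Im R)) (@Im_le_nc R) => [[a b] [c d]|r [a b]] //=.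
by rewrite mul0r addr0.
Qed.

Lemma cderiv_inv z : z != 0 -> cderiv (fun w => - w^-1) z (z ^- 2).
Proof.
move=> z0 e e0.
have n0 : 0 < nc z by rewrite nc_gt0.
pose d := Num.min (nc z / 2) (e * nc z ^+ 3 / 2).
exists d; first by rewrite lt_min !(divr_gt0, mulr_gt0, exprn_gt0).
move=> h; rewrite le_min => /andP[h1 h2].
have zh : nc z / 2 <= nc (z + h).
  have := ncD (z + h) (- h); rewrite addrK ncN; lra.
have zh0 : z + h != 0 by rewrite -nc_gt0; lra.
rewrite (_ : _ - _ = - (h ^+ 2 / (z ^+ 2 * (z + h)))); last first.
  by field; rewrite z0 zh0.
have -> : nc (- (h ^+ 2 / (z ^+ 2 * (z + h)))) = nc h * nc h / (nc z ^+ 2 * nc (z + h)).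
  by rewrite ncN !expr2 !(ncM, ncV).
rewrite ler_pdivrMr ?mulr_gt0 ?exprn_gt0 ?nc_gt0 //.
apply: le_trans (ler_wpM2l (nc_ge0 _) h2) _.
rewrite (_ : nc h * (e * nc z ^+ 3 / 2) = e * nc h * (nc z ^+ 2 * (nc z / 2))); last by ring.
by rewrite !ler_wpM2l ?exprn_ge0 ?mulr_ge0 ?nc_ge0 // ltW.
Qed.

End MeanValue.

(** * The exponentials q^r *)

Section Exponentials.
Variable R : realType.
Local Notation C := R[i].
Implicit Types (z w : C) (r : R).

Lemma cexpD z w : cexp (z + w) = cexp z * cexp w.
Proof.
case: z w => a b [c d]; rewrite /cexp /= expRD cosD sinD.
by apply/eqP; rewrite eq_complex /=; apply/andP; split; apply/eqP; ring.
Qed.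

Lemma cexp0 : cexp (0 : C) = 1.
Proof. by rewrite /cexp /= expR0 cos0 sin0 mul1r. Qed.

Lemma nc_cexp z : nc (cexp z) = expR (complex.Re z).
Proof.
rewrite /cexp ncM nc_real ger0_norm ?expR_ge0 //=.
by rewrite cos2Dsin2 sqrtr1 mulr1.
Qed.

(** By the addition formula it is enough to differentiate at [0], where the
    first order expansions of [expR], [cos] and [sin] combine. *)
Lemma cderiv_cexp z : cderiv (@cexp R) z (cexp z).
Proof.
suff H : forall e : R, 0 < e -> exists2 d : R, 0 < d &
    forall h, nc h <= d -> nc (cexp h - 1 - h) <= e * nc h.
  move=> e e0; have [d d0 hd] := H _ (divr_gt0 e0 (expR_gt0 (complex.Re z))).
  exists d => // h /hd hh.
  rewrite (_ : _ - _ = cexp z * (cexp h - 1 - h)); last by rewrite cexpD; ring.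
  rewrite ncM nc_cexp; apply: le_trans (ler_wpM2l (expR_ge0 _) hh) _.
  by rewrite mulrA [_ * (e / _)]mulrC divfK // gt_eqF ?expR_gt0.
(* The real and imaginary parts of the remainder at [0] are sums of four terms,
   bounded by [6 * e1 * n] in total; [e1 <= 1] keeps [expR s] below [2]. *)
move=> e e0; pose e1 := Num.min (e / 6) 1.
have e10 : 0 < e1 by rewrite lt_min divr_gt0 ?ltr01.
have e1e : e1 <= e / 6 by rewrite ge_min lexx.
have e11 : e1 <= 1 by rewrite ge_min lexx orbT.
have [d1 d10 h1] := (is_derive_epsP _ _ _).1 (is_derive_expR (0 : R)) e1 e10.
have [d2 d20 h2] := (is_derive_epsP _ _ _).1 (is_derive_cos (0 : R)) e1 e10.
have [d3 d30 h3] := (is_derive_epsP _ _ _).1 (is_derive_sin (0 : R)) e1 e10.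
exists (Num.min (Num.min d1 d2) (Num.min d3 (e1 / 2))).
  by rewrite !lt_min d10 d20 d30 divr_gt0.
move=> h; have := Re_le_nc h; have := Im_le_nc h.
case: h => s t; set n := nc _ => tn sn; rewrite /= in tn sn; rewrite !le_min => /andP[/andP[n1 n2] /andP[n3 n4]].
have := h1 _ (le_trans sn n1); have := h2 _ (le_trans tn n2); have := h3 _ (le_trans tn n3).
rewrite !add0r expR0 cos0 sin0 oppr0 mul1r mul0r !subr0 addr0 mul1r => {h1 h2 h3} hs hc he.
have es : `|expR s - 1| <= e1.
  have -> : expR s - 1 = (expR s - 1 - s) + s by ring.
  apply: le_trans (ler_normD _ _) _.
  have : e1 * `|s| <= `|s| by rewrite ler_piMl.
  lra.
have es2 : `|expR s| <= 2.
  have -> : expR s = (expR s - 1) + 1 by ring.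
  apply: le_trans (ler_normD _ _) _; rewrite normr1; lra.
have -> : cexp (s +i* t) - 1 - (s +i* t) =
    (expR s - 1 - s + expR s * (cos t - 1)) +i* (expR s * (sin t - t) + (expR s - 1) * t).
  have re (a c r : R) : a * c - 0 * r - 1 - s = a - 1 - s + a * (c - 1) by ring.
  have im (a c r : R) : a * r + 0 * c - 0 - t = a * (r - t) + (a - 1) * t by ring.
  by apply/eqP; rewrite /cexp eq_complex; apply/andP; split; apply/eqP; [exact: re | exact: im].
apply: le_trans (nc_le_ReIm _) _; rewrite [complex.Re _]/= [complex.Im _]/=.
have a1 : `|expR s - 1 - s| <= e1 * n by apply: le_trans he _; rewrite ler_wpM2l // ltW.
have hc1 : `|cos t - 1| <= e1 * n by apply: le_trans hc _; rewrite ler_wpM2l // ltW.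
have hs1 : `|sin t - t| <= e1 * n by apply: le_trans hs _; rewrite ler_wpM2l // ltW.
have a2 : `|expR s * (cos t - 1)| <= 2 * (e1 * n) by rewrite normrM; apply: ler_pM.
have a3 : `|expR s * (sin t - t)| <= 2 * (e1 * n) by rewrite normrM; apply: ler_pM.
have a4 : `|(expR s - 1) * t| <= e1 * n by rewrite normrM; apply: ler_pM.
have a5 : e1 * n <= e / 6 * n by rewrite ler_wpM2r // nc_ge0.
have := ler_normD (expR s - 1 - s) (expR s * (cos t - 1)).
have := ler_normD (expR s * (sin t - t)) ((expR s - 1) * t).
lra.
Qed.

Lemma qpowD r s z : qpow (r + s) z = qpow r z * qpow s z.
Proof.
by rewrite /qpow -cexpD; congr cexp; rewrite mulrDr rmorphD /= mulrDl mulrDl.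
Qed.

Lemma qpow0 z : qpow 0 z = 1.
Proof. by rewrite /qpow mulr0 !mul0r cexp0. Qed.

Lemma nc_qpow r z : nc (qpow r z) = expR (- (2 * pi * r * complex.Im z)).
Proof.
by rewrite /qpow nc_cexp; case: z => x y /=; congr expR; ring.
Qed.

Lemma cderiv_qpow r z : cderiv (qpow r) z ((2 * pi * r)%:C * 'i%C * qpow r z).
Proof.
rewrite mulrC; apply: (@cderiv_comp R (@cexp R)); last exact: cderiv_cexp.
by rewrite -[X in cderiv _ _ X]mulr1; apply: cderivZ; exact: cderiv_id.
Qed.

End Exponentials.

(** * Mean values along horizontal lines *)

Section Means.
Variable R : realType.
Local Notation C := R[i].
Implicit Types (z w c : C) (F : C -> C) (B : R -> R) (K : R).

(** If [F] is periodic and has a q-expansion, [c] is its constant coefficient.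
    A bound on the primitive, instead of a formula for its change over a period,
    makes the notion stable under finite sums with unrelated periods and under
    [z |-> p z + q] for every real [p > 0]. *)
Definition has_mean F c : Prop := exists Phi : C -> C,
  (forall z, upper_half z -> cderiv Phi z (F z)) /\
  (forall z, upper_half z -> exists b : R, forall t : R, nc (Phi (z + t%:C) - c * t%:C) <= b).

(** A quantitative form of [has_mean] that passes to infinite sums.  [B y] bounds
    [F] on the line of height [y], and the first clause, which bounds [B] on an
    interval by its values at the ends, holds for growing as well as for decaying
    exponentials; it turns summability of bounds at each height into local
    uniform summability.  The constant [K] controls the denominators created by
    integrating the nonconstant exponentials: it is an upper bound for the
    inverses of the nonzero exponents. *)
Definition mean_bound K F c B : Prop :=
  [/\ forall y0 y y1, 0 < y0 -> y0 <= y -> y <= y1 -> B y <= B y0 + B y1,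
      forall y, 0 < y -> nc c <= B y,
      forall z, upper_half z -> nc (F z) <= B (complex.Im z)
    & exists Phi : C -> C, forall z, upper_half z -> cderiv Phi z (F z) /\
        nc (Phi z - c * (complex.Re z)%:C) <= (K + complex.Im z) * B (complex.Im z)].

Lemma upper_half_real z (t : R) : upper_half z -> upper_half (z + t%:C).
Proof. by case: z => x y; rewrite /upper_half /= addr0. Qed.

Lemma mean_bound_mean K F c B : mean_bound K F c B -> has_mean F c.
Proof.
case=> _ _ _ [Phi hPhi]; exists Phi; split=> [z /hPhi[]//|z Hz].
exists ((K + complex.Im z) * B (complex.Im z) + nc (c * (complex.Re z)%:C)) => t.
have [_] := hPhi _ (upper_half_real t Hz).
have -> : complex.Im (z + t%:C) = complex.Im z by case: (z) => x y /=; rewrite addr0.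
have -> : complex.Re (z + t%:C) = complex.Re z + t by case: (z).
move=> h.
rewrite (_ : _ - _ = (Phi (z + t%:C) - c * (complex.Re z + t)%:C) + c * (complex.Re z)%:C).
  by apply: le_trans (ncD _ _) _; rewrite lerD2r.
by rewrite rmorphD /=; ring.
Qed.

Lemma mean_bound_ext K F F' c B B' :
  (forall z, upper_half z -> F z = F' z) -> (forall y, 0 < y -> B y = B' y) ->
  mean_bound K F c B -> mean_bound K F' c B'.
Proof.
move=> FF BB [B1 B2 B3 [Phi hPhi]]; split.
- move=> y0 y y1 y00 y01 y11; have yp := lt_le_trans y00 y01.
  by rewrite -!BB ?B1 //; exact: lt_le_trans y11.
- by move=> y y0; rewrite -BB // B2.
- by move=> z Hz; rewrite -FF // -BB // B3.
- by exists Phi => z Hz; rewrite -FF // -BB //; exact: hPhi.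
Qed.

Lemma mean_boundZ K F c B a :
  mean_bound K F c B -> mean_bound K (fun z => a * F z) (a * c) (fun y => nc a * B y).
Proof.
move=> [B1 B2 B3 [Phi hPhi]]; split.
- by move=> y0 y y1 h0 h1 h2; rewrite -mulrDr ler_wpM2l ?nc_ge0 // B1.
- by move=> y y0; rewrite ncM ler_wpM2l ?nc_ge0 // B2.
- by move=> z Hz; rewrite ncM ler_wpM2l ?nc_ge0 // B3.
- exists (fun z => a * Phi z) => z Hz; have [h1 h2] := hPhi z Hz; split.
    exact: cderivZ.
  by rewrite -mulrA -mulrBr ncM mulrCA ler_wpM2l ?nc_ge0.
Qed.

(** For [r != 0] the primitive is [q^r / (2 pi i r)], and [2 pi >= 1]; for
    [r = 0] it is the identity. *)
Lemma mean_bound_qpow K (r : R) : 0 <= K -> (r = 0 \/ 1 <= K * `|r|) ->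
  mean_bound K (qpow r) (r == 0)%:R (fun y => expR (- (2 * pi * r * y))).
Proof.
move=> K0 Kr; split.
- move=> y0 y y1 y00 y01 y11; have pi0 := pi_ge0 R.
  have [r0|r0] := lerP 0 r.
    apply: ler_wpDr; first exact: expR_ge0.
    by rewrite ler_expR lerN2 ler_wpM2l // !mulr_ge0.
  apply: ler_wpDl; first exact: expR_ge0.
  by rewrite ler_expR lerN2 ler_wnM2l // mulr_ge0_le0 ?mulr_ge0 // ltW.
- move=> y y0; case: eqVneq => [->|r0]; last by rewrite nc0 expR_ge0.
  by rewrite mulr0 mul0r oppr0 expR0 nc1.
- by move=> z _; rewrite nc_qpow.
case: eqVneq Kr => [-> _|r0 [r00|Kr]].
- exists id => z Hz; split.
    by rewrite qpow0; exact: cderiv_id.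
  rewrite mul1r mulr0 mul0r oppr0 expR0 mulr1 {1}(complexE z) addrAC subrr add0r.
  by rewrite nc_imag ger0_norm ?lerDr // ltW.
- by rewrite r00 eqxx in r0.
pose l : C := (2 * pi * r)%:C * 'i%C.
have pi2 := pi_ge2 R.
have l0 : l != 0.
  rewrite mulf_neq0 //; last by rewrite eq_complex /= oner_eq0 andbF.
  by rewrite fmorph_eq0 mulf_neq0 // mulf_neq0 // gt_eqF // pi_gt0.
exists (fun z => l^-1 * qpow r z) => z Hz; split.
  rewrite -[qpow r z](mulKf l0); apply: cderivZ; exact: cderiv_qpow.
rewrite mul0r subr0 ncM ncV nc_qpow ler_pM2r ?expR_gt0 //.
have r1 : 0 < `|r| by rewrite normr_gt0.
have nl : nc l = 2 * pi * `|r|.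
  have i1 : nc ('i%C : C) = 1.
    by rewrite -[X in nc X]mulr1 -(rmorph1 (real_complex R)) nc_imag normr1.
  by rewrite ncM i1 nc_real mulr1 normrM ger0_norm // mulr_ge0 //; lra.
have : (nc l)^-1 <= K.
  rewrite nl -div1r ler_pdivrMr ?mulr_gt0 //; last by lra.
  rewrite mulrCA; apply: mulr_ege1 => //; lra.
move/le_trans; apply; rewrite lerDl; exact: ltW.
Qed.

End Means.

Section MeanOfSeries.
Variable R : realType.
Local Notation C := R[i].
Implicit Types (z w c : C) (F : C -> C) (B : R -> R) (K : R).

Lemma series_le_lim (b : nat -> R) : (forall n, 0 <= b n) -> cvgn (series b) ->
  forall n, series b n <= limn (series b).
Proof.
move=> b0 cb n; apply: nondecreasing_cvgn_le cb n.
by apply: nondecreasing_series.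
Qed.

Lemma nc_series_le (u : nat -> C) (b : nat -> R) n :
  (forall k, nc (u k) <= b k) -> nc (series u n) <= series b n.
Proof. by move=> ub; apply: le_trans (nc_sum _ _ _) _; apply: ler_sum. Qed.

Lemma clim_series_bound (u : nat -> C) (b : nat -> R) l :
  (forall k, nc (u k) <= b k) -> cvgn (series b) -> clim (series u) l ->
  nc l <= limn (series b).
Proof.
move=> ub cb ul; apply: (clim_le (N := 0%N) ul) => n _.
apply: le_trans (nc_series_le n ub) _; apply: series_le_lim => // k.
by apply: le_trans (ub k); exact: nc_ge0.
Qed.

(** A series whose terms have derivatives dominated near [z] may be
    differentiated termwise: beyond a large index the mean value inequality makes
    the difference quotients of the tail uniformly small. *)
Lemma cderiv_series (Phi_ F_ : nat -> C -> C) (Phi F : C -> C) (M : nat -> R) z (r : R) :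
  0 < r -> cvgn (series M) ->
  (forall k h, nc h <= r -> cderiv (Phi_ k) (z + h) (F_ k (z + h)) /\ nc (F_ k (z + h)) <= M k) ->
  (forall h, nc h <= r -> clim (series (Phi_ ^~ (z + h))) (Phi (z + h))) ->
  clim (series (F_ ^~ z)) (F z) -> cderiv Phi z (F z).
Proof.
move=> r0 cM dPhi hPhi hF.
have r00 : nc (0 : C) <= r by rewrite nc0 ltW.
have M0 k : 0 <= M k.
  by have [_] := dPhi k 0 r00; apply: le_trans; exact: nc_ge0.
move=> e e0; pose e1 := e / 4; have e10 : 0 < e1 by rewrite divr_gt0.
have [N hN] : exists N, limn (series M) - series M N <= e1.
  move/cvgrPdist_le : (cM) => /(_ _ e10)[N _ hN]; exists N.
  by apply: le_trans (hN N (leqnn N)); rewrite ler_norm.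
have tail n : (N <= n)%N -> \sum_(N <= k < n) M k <= e1.
  move=> Nn; apply: le_trans hN; rewrite -(sub_series_geq M Nn).
  by rewrite lerD2r; exact: series_le_lim.
have [d d0 hd] : exists2 d : R, 0 < d & forall h, nc h <= d ->
    nc (series (Phi_ ^~ (z + h)) N - series (Phi_ ^~ z) N - series (F_ ^~ z) N * h) <= e1 * nc h.
  have [] := @cderiv_sum R nat (index_iota 0 N) Phi_ (F_ ^~ z) z _ e1 e10; last by move=> d; exists d.
  by move=> k; have [] := dPhi k 0 r00; rewrite addr0.
exists (Num.min d r); first by rewrite lt_min d0.
move=> h; rewrite le_min => /andP[hhd hhr].
have t1 : nc ((Phi (z + h) - Phi z) - (series (Phi_ ^~ (z + h)) N - series (Phi_ ^~ z) N))
    <= 2 * e1 * nc h.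
  have hc : clim (fun n => (series (Phi_ ^~ (z + h)) n - series (Phi_ ^~ z) n)
      - (series (Phi_ ^~ (z + h)) N - series (Phi_ ^~ z) N))
      ((Phi (z + h) - Phi z) - (series (Phi_ ^~ (z + h)) N - series (Phi_ ^~ z) N)).
    apply: climD (@clim_cst R _); apply: climD (hPhi _ hhr) _.
    have := climZ (-1) (hPhi _ r00); rewrite addr0 mulN1r.
    by apply: (clim_ext (N := 0%N)) => n _; rewrite mulN1r.
  apply: (clim_le (N := N) hc) => n Nn.
  rewrite (_ : _ - _ = (series (Phi_ ^~ (z + h)) n - series (Phi_ ^~ (z + h)) N)
    - (series (Phi_ ^~ z) n - series (Phi_ ^~ z) N)); last by ring.
  rewrite !sub_series_geq // -sumrB.
  apply: le_trans (nc_sum _ _ _) _.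
  apply: le_trans (_ : \sum_(N <= k < n) (2 * M k * nc h) <= _).
    apply: ler_sum => k _.
    have := @mean_value_le R (Phi_ k) (F_ k) z (z + h) (M k).
    rewrite [z + h - z]addrC addKr; apply => t /andP[t0 t1].
    apply: dPhi; rewrite ncM nc_real ger0_norm //; apply: le_trans hhr.
    by rewrite ler_piMl ?nc_ge0.
  by rewrite -mulr_suml -mulr_sumr ler_wpM2r ?nc_ge0 // ler_wpM2l // tail.
have t2 : nc (F z - series (F_ ^~ z) N) <= e1.
  have hc := climD hF (@clim_cst R (- series (F_ ^~ z) N)).
  apply: (clim_le (N := N) hc) => n Nn; rewrite sub_series_geq //.
  apply: le_trans (nc_sum _ _ _) _; apply: le_trans (tail n Nn).
  by apply: ler_sum => k _; have [_] := dPhi k 0 r00; rewrite addr0.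
set P := series _ N - series _ N in t1; have {}hd := hd _ hhd; rewrite -/P in hd.
set S := series _ N in t2 hd.
rewrite (_ : _ - _ = (Phi (z + h) - Phi z - P) + (P - S * h) - (F z - S) * h); last by ring.
apply: le_trans (ncD _ _) _; rewrite ncN ncM.
have t3 : nc (F z - S) * nc h <= e1 * nc h by rewrite ler_wpM2r ?nc_ge0.
have := ncD (Phi (z + h) - Phi z - P) (P - S * h).
rewrite /e1 in t1 t2 t3 hd *; lra.
Qed.

(** Termwise integration.  The primitives of the terms are dominated by the
    bounds [B_ k], up to a factor that depends on [z] only, so their sum
    converges, and [cderiv_series] applies in a strip around [z]. *)
Lemma mean_bound_series K (F_ : nat -> C -> C) (c_ : nat -> C) (B_ : nat -> R -> R) F :
  0 <= K ->
  (forall k, mean_bound K (F_ k) (c_ k) (B_ k)) ->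
  (forall y, 0 < y -> cvgn (series (B_ ^~ y))) ->
  (forall z, upper_half z -> clim (series (F_ ^~ z)) (F z)) ->
  exists c, clim (series c_) c /\ mean_bound K F c (fun y => limn (series (B_ ^~ y))).
Proof.
move=> K0 mb cB hF.
have B0 k y : 0 < y -> 0 <= B_ k y.
  by move=> y0; have [_ h _ _] := mb k; apply: le_trans (h y y0); exact: nc_ge0.
have /choice[Phi_ hPhi_] k : exists Psi : C -> C, forall z, upper_half z ->
    cderiv Psi z (F_ k z) /\
    nc (Psi z - c_ k * (complex.Re z)%:C) <= (K + complex.Im z) * B_ k (complex.Im z).
  by have [_ _ _] := mb k.
have cle k y : 0 < y -> nc (c_ k) <= B_ k y by have [_ h _ _] := mb k; exact: h.
have Fle k z : upper_half z -> nc (F_ k z) <= B_ k (complex.Im z).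
  by have [_ _ h _] := mb k; exact: h.
have [c hc] : exists c, clim (series c_) c.
  by apply: (@clim_series_exists _ _ (B_ ^~ 1)) => [k|]; [exact: cle | exact: cB].
have /choice[Phi hPhi] z : exists l, upper_half z -> clim (series (Phi_ ^~ z)) l.
  have [Hz|nHz] := pselect (upper_half z); last by exists 0.
  have [l hl] : exists l, clim (series (Phi_ ^~ z)) l; last by exists l.
  apply: (@clim_series_exists _ _
    (fun k => (K + complex.Im z + `|complex.Re z|) * B_ k (complex.Im z))) => [k|].
    rewrite -[Phi_ k z](subrK (c_ k * (complex.Re z)%:C)); apply: le_trans (ncD _ _) _.
    rewrite [leRHS]mulrDl; apply: lerD; first exact: (hPhi_ k z Hz).2.
    by rewrite ncM nc_real mulrC ler_wpM2l ?cle.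
  exact: is_cvg_seriesZ (cB _ Hz).
exists c; split=> //; split.
- move=> y0 y y1 y00 y01 y11.
  have yp := lt_le_trans y00 y01; have y1p := lt_le_trans yp y11.
  apply: limr_le; first exact: cB.
  near=> n; apply: le_trans (_ : series (B_ ^~ y0) n + series (B_ ^~ y1) n <= _).
    rewrite /series /= -big_split /=; apply: ler_sum => k _.
    by have [h _ _ _] := mb k; exact: h.
  by apply: lerD; apply: series_le_lim => *; [exact: B0 | exact: cB | exact: B0 | exact: cB].
- by move=> y y0; apply: (@clim_series_bound c_) => // [k|]; [exact: cle | exact: cB].
- by move=> z Hz; apply: (@clim_series_bound (F_ ^~ z)) => [k||]; [exact: Fle | exact: cB | exact: hF].
exists Phi => z Hz; split.
  have y0 : 0 < complex.Im z by [].
  pose y1 := complex.Im z / 2; pose y2 := 2 * complex.Im z.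
  have y10 : 0 < y1 by rewrite divr_gt0.
  have y20 : 0 < y2 by rewrite mulr_gt0.
  have near_z h : nc h <= y1 ->
      [/\ upper_half (z + h), y1 <= complex.Im (z + h) & complex.Im (z + h) <= y2].
    move=> /(le_trans (Im_le_nc _)); rewrite ler_norml => /andP[h1 h2].
    have E : complex.Im (z + h) = complex.Im z + complex.Im h by case: (z) (h) => ? ? [].
    rewrite /y1 /y2 /upper_half /= E in h1 h2 *; split; lra.
  apply: (@cderiv_series Phi_ F_ Phi F ((B_ ^~ y1) + (B_ ^~ y2)) z y1) => //.
  - by apply: is_cvg_seriesD; exact: cB.
  - move=> k h /near_z[Hh h1 h2]; split; first exact: (hPhi_ k _ Hh).1.
    apply: le_trans (Fle k _ Hh) _.
    by have [hB _ _ _] := mb k; exact: hB.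
  - by move=> h /near_z[Hh _ _]; exact: hPhi.
  - exact: hF.
have hcl : clim (series (fun k => Phi_ k z - c_ k * (complex.Re z)%:C))
                (Phi z - c * (complex.Re z)%:C).
  have := climD (hPhi z Hz) (climZ (- (complex.Re z)%:C) hc).
  rewrite mulNr [_ * c]mulrC; apply: (clim_ext (N := 0%N)) => n _.
  by rewrite /series /= mulNr mulr_sumr -sumrB; apply: eq_bigr => k _; rewrite [_ * c_ k]mulrC.
rewrite -[leRHS](lim_seriesZ (K + complex.Im z) (cB _ Hz)).
apply: clim_series_bound hcl => [k|]; first exact: (hPhi_ k z Hz).2.
exact: is_cvg_seriesZ (cB _ Hz).
Unshelve. all: by end_near.
Qed.

End MeanOfSeries.

(** * Products of q-series *)

Section QSeries.
Variable R : realType.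
Local Notation C := R[i].
Implicit Types (z c : C) (f g : C -> C) (a b : nat -> C) (x y : nat -> R) (K : R).

Definition qseries f a x : Prop :=
  forall z, upper_half z -> clim (series (fun n => a n * qpow (x n) z)) (f z).

Definition is_arithmetic x : Prop :=
  exists x0 d : R, 0 < d /\ forall n, x n = x0 + d * n%:R.

Lemma clim_series_bounded (u : nat -> C) (l : C) :
  clim (series u) l -> exists M : R, forall n, nc (u n) <= M.
Proof.
move=> /(_ 1 ltr01)[N hN].
exists (2 + \sum_(0 <= k < N) nc (u k)) => n.
have [nN|Nn] := ltnP n N.
  rewrite [X in _ + X](big_rem n) ?mem_index_iota //= addrCA lerDl addr_ge0 //.
  by apply: sumr_ge0 => k _; exact: nc_ge0.
apply: ler_wpDr; first by apply: sumr_ge0 => k _; exact: nc_ge0.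
have -> : u n = (series u n.+1 - l) - (series u n - l).
  by rewrite opprB addrA subrK /series /= big_nat_recr //= addrAC subrr add0r.
apply: le_trans (ncD _ _) _; rewrite ncN -[2](_ : 1 + 1 = _) //.
by apply: lerD; apply: hN => //; exact: leqW.
Qed.

(** The terms are bounded at height [y / 2], hence geometrically small at
    height [y]. *)
Lemma qseries_abs f a x : is_arithmetic x -> qseries f a x ->
  forall y : R, 0 < y -> cvgn (series (fun n => nc (a n) * expR (- (2 * pi * x n * y)))).
Proof.
move=> [x0 [d [d0 hx]]] hf y y0.
have Hz : upper_half (0 +i* (y / 2)) by rewrite /upper_half /= divr_gt0.
have [M hM] := clim_series_bounded (hf _ Hz).
have pi0 := pi_gt0 R.
pose q := expR (- (pi * d * y)); pose A := M * expR (- (pi * x0 * y)).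
apply: (@series_le_cvg _ _ (geometric A q)).
- by move=> n; rewrite mulr_ge0 ?nc_ge0 ?expR_ge0.
- move=> n; rewrite /= !mulr_ge0 ?exprn_ge0 ?expR_ge0 //.
  by apply: le_trans (hM 0%N); exact: nc_ge0.
- move=> n; have := hM n; rewrite ncM nc_qpow /= => h.
  have -> : expR (- (2 * pi * x n * y)) =
      expR (- (2 * pi * x n * (y / 2))) * expR (- (pi * x n * y)).
    by rewrite -expRD; congr expR; field.
  have -> : A * q ^+ n = M * expR (- (pi * x n * y)).
    by rewrite /A /q -expRM_natl -mulrA -expRD; congr (_ * expR _); rewrite hx; ring.
  by rewrite [leLHS]mulrA ler_wpM2r ?expR_ge0.
- apply: is_cvg_geometric_series; rewrite ger0_norm ?expR_ge0 //.
  by rewrite expR_lt1 oppr_lt0 !mulr_gt0.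
Qed.

(** The mean of [q^s f] is the coefficient of [q^(-s)] in [f], written as a sum
    because the exponent [- s] need not occur in [x]. *)
Lemma mean_qpow_qseries f a x (s : R) K : 0 <= K -> is_arithmetic x -> qseries f a x ->
  (forall n, s + x n = 0 \/ 1 <= K * `|s + x n|) ->
  exists c, clim (series (fun n => a n * (s + x n == 0)%:R)) c /\
    mean_bound K (fun z => qpow s z * f z) c
     (fun t => expR (- (2 * pi * s * t)) *
               limn (series (fun n => nc (a n) * expR (- (2 * pi * x n * t))))).
Proof.
move=> K0 ax hf hK; have cB := qseries_abs ax hf.
pose B_ n t := nc (a n) * expR (- (2 * pi * (s + x n) * t)).
have BE t : (fun n => B_ n t) = expR (- (2 * pi * s * t)) *:
    (fun n => nc (a n) * expR (- (2 * pi * x n * t))).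
  apply/funext => n; rewrite /B_ -[RHS]/(expR _ * (_ * _)) mulrCA -expRD.
  by congr (_ * expR _); ring.
have [|t t0|z Hz|c [hc mb]] := @mean_bound_series R K
   (fun n z => a n * qpow (s + x n) z) (fun n => a n * (s + x n == 0)%:R) B_
   (fun z => qpow s z * f z) K0.
- by move=> n; apply: mean_boundZ; exact: mean_bound_qpow.
- by rewrite BE; apply: is_cvg_seriesZ; exact: cB.
- have := climZ (qpow s z) (hf z Hz); apply: (clim_ext (N := 0%N)) => n _.
  by rewrite /series /= mulr_sumr; apply: eq_bigr => k _; rewrite mulrCA -qpowD.
exists c; split=> //; apply: mean_bound_ext mb => // t t0.
by rewrite BE lim_seriesZ //; exact: cB.
Qed.

(** The constant coefficient of the product series, organised as the sum over
    [n] of [a n] times the coefficient [d n] of [g] at the exponent opposite to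
    [x n].  Termwise integration is used for the sum over [n] of [a_n q^(x_n) g],
    whose terms are covered by [mean_qpow_qseries]; no Cauchy product is formed,
    so that the two progressions may have unrelated steps. *)
Lemma mean_qseriesM f a x g b y d K : 0 <= K ->
  is_arithmetic x -> is_arithmetic y -> qseries f a x -> qseries g b y ->
  (forall n m, x n + y m = 0 \/ 1 <= K * `|x n + y m|) ->
  (forall n, clim (series (fun m => b m * (x n + y m == 0)%:R)) (d n)) ->
  exists c, clim (series (fun n => a n * d n)) c /\ has_mean (fun z => f z * g z) c.
Proof.
move=> K0 ax ay hf hg hK hd.
pose Bg t := limn (series (fun m => nc (b m) * expR (- (2 * pi * y m * t)))).
pose B_ n t := nc (a n) * (expR (- (2 * pi * x n * t)) * Bg t).
have [|t t0|z Hz|c [hc mb]] := @mean_bound_series R K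
   (fun n z => a n * (qpow (x n) z * g z)) (fun n => a n * d n) B_
   (fun z => f z * g z) K0.
- move=> n; apply: mean_boundZ.
  have [c [hc mb]] := mean_qpow_qseries K0 ay hg (hK n).
  by rewrite (clim_uniq (hd n) hc).
- have -> : B_ ^~ t = Bg t *: (fun n => nc (a n) * expR (- (2 * pi * x n * t))).
    by apply/funext => n; rewrite /B_ -[RHS]/(Bg t * (_ * _)) [LHS]mulrA [LHS]mulrC.
  by apply: is_cvg_seriesZ; exact: (qseries_abs ax hf).
- have := climZ (g z) (hf z Hz); rewrite mulrC; apply: (clim_ext (N := 0%N)) => n _.
  by rewrite /series /= mulr_sumr; apply: eq_bigr => k _; rewrite mulrC mulrA.
by exists c; split=> //; exact: mean_bound_mean mb.
Qed.

End QSeries.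

Section MeanAlgebra.
Variable R : realType.
Local Notation C := R[i].
Implicit Types (z w c : C) (F Phi Psi : C -> C).

Lemma upper_half_segment z w (t : R) : upper_half z -> upper_half w -> 0 <= t <= 1 ->
  upper_half (z + t%:C * (w - z)).
Proof.
case: z w => [x y] [x' y'] Hz Hw /andP[t0 t1].
rewrite /upper_half /= in Hz Hw *; rewrite mul0r addr0.
rewrite (_ : _ + _ = (1 - t) * y + t * y'); last by ring.
have [->|tn] := eqVneq t 1; first by rewrite subrr mul0r mul1r add0r.
apply: ltr_pwDl; first by rewrite mulr_gt0 // subr_gt0 lt_neqAle tn.
by rewrite mulr_ge0 // ltW.
Qed.

(** The difference of two primitives has derivative [0] on a convex domain. *)
Lemma primitive_uniq F Phi Psi z w :
  (forall z, upper_half z -> cderiv Phi z (F z)) ->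
  (forall z, upper_half z -> cderiv Psi z (F z)) ->
  upper_half z -> upper_half w -> Psi z - Phi z = Psi w - Phi w.
Proof.
move=> dPhi dPsi Hz Hw; apply/eqP; rewrite -subr_eq0 -nc_eq0 eq_le nc_ge0 andbT.
have := @mean_value_le R (fun u => Psi u + (-1) * Phi u) (fun=> 0) w z 0.
rewrite mulr0 mul0r !mulN1r; apply => t t01.
have Hu := upper_half_segment Hw Hz t01.
split; last by rewrite nc0.
have := cderivD (dPsi _ Hu) (cderivZ (-1) (dPhi _ Hu)).
by rewrite mulN1r subrr.
Qed.

Lemma bounded_multiples_eq0 c (b : R) : (forall n : nat, nc (c * n%:R%:C) <= b) -> c = 0.
Proof.
move=> H; apply/eqP; rewrite -nc_eq0; apply: contraT => c0.
have cp : 0 < nc c by rewrite lt_neqAle eq_sym c0 nc_ge0.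
have := H (Num.truncn (b / nc c)).+1; rewrite ncM nc_real normr_nat leNgt.
by rewrite mulrC -ltr_pdivrMr // truncnS_gt.
Qed.

(** Two primitives differ by a constant, so [(c - c') n] is bounded in [n]. *)
Lemma has_mean_uniq F c c' : has_mean F c -> has_mean F c' -> c = c'.
Proof.
move=> [Phi [dPhi bPhi]] [Psi [dPsi bPsi]].
have Hi : upper_half ('i%C : C) by rewrite /upper_half /=.
have [b hb] := bPhi _ Hi; have [b' hb'] := bPsi _ Hi.
apply/eqP; rewrite -subr_eq0; apply/eqP.
apply: (@bounded_multiples_eq0 _ (b + b' + nc (Psi 'i%C - Phi 'i%C))) => n.
have E := primitive_uniq dPhi dPsi (upper_half_real n%:R Hi) Hi.
set u := 'i%C + _ in E.
rewrite (_ : _ * _ = - (Phi u - c * n%:R%:C) + (Psi u - c' * n%:R%:C) - (Psi u - Phi u)); last by ring.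
rewrite E; apply: le_trans (ncD _ _) _; rewrite ncN; apply: lerD => //.
by apply: le_trans (ncD _ _) _; rewrite ncN; apply: lerD; [exact: hb | exact: hb'].
Qed.

Lemma has_mean_ext F F' c : (forall z, upper_half z -> F z = F' z) ->
  has_mean F c -> has_mean F' c.
Proof.
by move=> FF [Phi [d b]]; exists Phi; split=> // z Hz; rewrite -FF //; exact: d.
Qed.

Lemma has_mean_sum (n : nat) (F_ : 'I_n -> C -> C) (c_ : 'I_n -> C) :
  (forall i, has_mean (F_ i) (c_ i)) ->
  has_mean (fun z => \sum_(i < n) F_ i z) (\sum_(i < n) c_ i).
Proof.
move=> /choice[Phi_ hPhi]; exists (fun z => \sum_(i < n) Phi_ i z); split=> z Hz.
  elim: (index_enum _) => [|i s IH].
    rewrite big_nil (_ : (fun _ => _) = fun=> 0); first exact: cderiv_cst.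
    by apply/funext => w; rewrite big_nil.
  rewrite big_cons (_ : (fun _ => _) = fun w => Phi_ i w + \sum_(i <- s) Phi_ i w).
    by apply: cderivD IH; exact: (hPhi i).1.
  by apply/funext => w; rewrite big_cons.
have /choice[b hb] i := (hPhi i).2 z Hz.
exists (\sum_(i < n) b i) => t; rewrite mulr_suml -sumrB.
by apply: le_trans (nc_sum _ _ _) _; apply: ler_sum => i _; exact: hb.
Qed.

Lemma has_mean_affine F c (p q : R) : 0 < p -> has_mean F c ->
  has_mean (fun z => p%:C * F (p%:C * z + q%:C)) (p%:C * c).
Proof.
move=> p0 [Phi [dPhi bPhi]].
have Hpq z : upper_half z -> upper_half (p%:C * z + q%:C).
  by case: z => x y; rewrite /upper_half /= mul0r !addr0 => ?; rewrite mulr_gt0.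
exists (fun z => Phi (p%:C * z + q%:C)); split=> z Hz.
  rewrite [_ * F _]mulrC.
  apply: (@cderiv_comp _ Phi (fun w => p%:C * w + q%:C)) (dPhi _ (Hpq z Hz)).
  rewrite -[X in cderiv _ _ X]addr0; apply: cderivD (cderiv_cst _ _).
  by rewrite -[X in cderiv _ _ X]mulr1; apply: cderivZ; exact: cderiv_id.
have [b hb] := bPhi _ (Hpq z Hz); exists b => t.
have := hb (p * t); rewrite rmorphM /=; congr (nc (Phi _ - _) <= _); ring.
Qed.

(** The vanishing of the constant term in level one.  A primitive changes by a
    constant under each of [z |-> -1/z] and [z |-> z + 1]; the fixed point [i]
    shows that the first constant is [0], and the cube root of unity [rho],
    for which [-1/rho = rho + 1], then shows that the second one is [0] too. *)
Lemma level_one_mean_eq0 F c :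
  (forall z, upper_half z -> F (z + 1) = F z) ->
  (forall z, upper_half z -> z ^- 2 * F (- z^-1) = F z) ->
  has_mean F c -> c = 0.
Proof.
move=> FT FS [Phi [dPhi bPhi]].
have Hi : upper_half ('i%C : C) by rewrite /upper_half /=.
have H0 z : upper_half z -> z != 0.
  by case: z => x y; rewrite /upper_half eq_complex /= => y0; rewrite negb_and (gt_eqF y0) orbT.
have HS z : upper_half z -> upper_half (- z^-1).
  case: z => x y; rewrite /upper_half /= => y0; rewrite opprK divr_gt0 //.
  by rewrite ltr_wpDl ?sqr_ge0 ?exprn_gt0.
have dS z : upper_half z -> cderiv (fun z => Phi (- z^-1)) z (F z).
  move=> Hz; rewrite -FS // mulrC; apply: (@cderiv_comp _ Phi (fun w => - w^-1)) (dPhi _ (HS z Hz)).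
  by apply: cderiv_inv; exact: H0.
have dT z : upper_half z -> cderiv (fun z => Phi (z + 1)) z (F z).
  move=> Hz; rewrite -FT // -[F _]mulr1.
  apply: (@cderiv_comp _ Phi (fun w => w + 1)) (dPhi _ (upper_half_real 1 Hz)).
  by rewrite -[X in cderiv _ _ X]addr0; apply: cderivD (cderiv_cst _ _); exact: cderiv_id.
have iS : - ('i%C : C)^-1 = 'i%C.
  have := sqr_i R; rewrite expr2 => /(canRL (mulKf (H0 _ Hi))) iE.
  by rewrite [RHS]iE mulrN1.
have PhiS z : upper_half z -> Phi (- z^-1) = Phi z.
  move=> Hz; have := primitive_uniq dPhi dS Hz Hi.
  by rewrite iS subrr => /eqP; rewrite subr_eq0 => /eqP.
pose s : R := Num.sqrt 3 / 2.
pose rho : C := (- (1 / 2)) +i* s.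
have s2 : s * s = 3 / 4.
  by rewrite /s mulrACA -expr2 sqr_sqrtr // -invfM; congr (_ / _); ring.
have Hrho : upper_half rho by rewrite /upper_half /= divr_gt0 // sqrtr_gt0.
have rhoE : rho * (rho + 1) = -1.
  apply/eqP; rewrite eq_complex /=; apply/andP; split; apply/eqP.
    by rewrite addr0 s2; field.
  by rewrite addr0 oppr0; field.
have rhoS : - rho^-1 = rho + 1.
  by move/(canRL (mulKf (H0 _ Hrho))) : rhoE => rE; rewrite [RHS]rE mulrN1.
have PhiT z : upper_half z -> Phi (z + 1) = Phi z.
  move=> Hz; have := primitive_uniq dPhi dT Hz Hrho.
  by rewrite -rhoS PhiS // subrr => /eqP; rewrite subr_eq0 => /eqP.
have PhiTn n : Phi ('i%C + n%:R%:C) = Phi 'i%C.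
  elim: n => [|n IH]; first by rewrite addr0.
  by rewrite -natr1 rmorphD /= addrA PhiT //; exact: upper_half_real.
have [b hb] := bPhi _ Hi.
apply: (@bounded_multiples_eq0 _ (b + nc (Phi 'i%C))) => n.
have := hb n%:R; rewrite PhiTn => h.
rewrite (_ : _ * _ = - (Phi 'i%C - c * n%:R%:C) + Phi 'i%C); last by ring.
by apply: le_trans (ncD _ _) _; rewrite ncN lerD2r.
Qed.

End MeanAlgebra.

(** * The weight two action and the trace to level one *)

Section WeightTwo.
Variable R : realType.
Local Notation C := R[i].
Local Notation M2 := 'M[R]_2.
Implicit Types (z : C) (g h : M2) (F : C -> C) (G : set M2).

Lemma ord2_0 (h : (0 < 2)%N) : Ordinal h = 0. Proof. exact/val_inj. Qed.
Lemma ord2_1 (h : (1 < 2)%N) : Ordinal h = 1. Proof. exact/val_inj. Qed.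

Lemma det22 g : \det g = g 0 0 * g 1 1 - g 0 1 * g 1 0.
Proof.
rewrite (expand_det_row _ 0) !big_ord_recl big_ord0 /cofactor !det_mx11 !mxE /=.
rewrite expr0 expr1 mul1r addr0 mulN1r mulrN.
by congr (_ * g _ _ - g _ _ * g _ _); apply/val_inj.
Qed.

Lemma mulmx22 g h i j : (g *m h) i j = g i 0 * h 0 j + g i 1 * h 1 j.
Proof.
rewrite mxE !big_ord_recl big_ord0 addr0.
by congr (_ + g _ _ * h _ _); apply/val_inj.
Qed.

Lemma im_linear (c d : R) z : complex.Im (c%:C * z + d%:C) = c * complex.Im z.
Proof. by case: z => x y /=; rewrite mul0r !addr0. Qed.

Lemma denom_neq0 g z : \det g = 1 -> upper_half z -> denom g z != 0.
Proof.
move=> dg Hz; apply/eqP => /[dup] D0.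
have /eqP : complex.Im (denom g z) = 0 by rewrite D0.
rewrite im_linear mulf_eq0 (gt_eqF Hz) orbF => /eqP c0.
rewrite /denom c0 mul0r add0r => /(@complexI _ _ 0) d0.
by move: dg; rewrite det22 c0 d0 !mulr0 subrr => /eqP; rewrite eq_sym oner_eq0.
Qed.

Lemma mobius_upper g z : \det g = 1 -> upper_half z -> upper_half (mobius g z).
Proof.
move=> dg Hz; have D0 := denom_neq0 dg Hz; rewrite -nc_gt0 in D0.
rewrite /mobius; set D := denom g z in D0 *; set N := _ + _.
have NE : N = (g 0 0 * complex.Re z + g 0 1) +i* (g 0 0 * complex.Im z).
  by rewrite /N; case: (z) => x y; apply/eqP; rewrite eq_complex /= !mul0r !addr0 subr0 !eqxx.
have DE : D = (g 1 0 * complex.Re z + g 1 1) +i* (g 1 0 * complex.Im z).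
  by rewrite /D /denom; case: (z) => x y; apply/eqP; rewrite eq_complex /= !mul0r !addr0 subr0 !eqxx.
rewrite DE in D0 *; rewrite NE /upper_half /=.
set u := g 1 0 * _ + _ in D0 *; set v := g 1 0 * _ in D0 *.
have n0 : 0 < u ^+ 2 + v ^+ 2 by move: D0; rewrite /= sqrtr_gt0.
have E (p q m : R) : p * - (v / m) + q * (u / m) = (q * u - p * v) / m by ring.
rewrite E divr_gt0 // (_ : _ - _ = complex.Im z * \det g); first by rewrite dg mulr1.
by rewrite det22 /u /v; ring.
Qed.

Lemma denomM g h z : \det h = 1 -> upper_half z ->
  denom (g *m h) z = denom g (mobius h z) * denom h z.
Proof.
move=> dh Hz; have D0 := denom_neq0 dh Hz.
rewrite {1}/denom !mulmx22 {1}/denom /mobius mulrDl -mulrA [_ / _ * _]mulfVK //.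
by rewrite /denom !(rmorphD, rmorphM) /=; ring.
Qed.

Lemma mobiusM g h z : \det h = 1 -> \det g = 1 -> upper_half z ->
  mobius (g *m h) z = mobius g (mobius h z).
Proof.
move=> dh dg Hz; have D0 := denom_neq0 dh Hz.
have D1 := denom_neq0 dg (mobius_upper dh Hz).
rewrite [LHS]/mobius denomM //.
have -> : ((g *m h) 0 0)%:C * z + ((g *m h) 0 1)%:C =
    ((g 0 0)%:C * mobius h z + (g 0 1)%:C) * denom h z.
  rewrite mulrDl -mulrA divfK // !mulmx22 /denom !(rmorphD, rmorphM) /=; ring.
by rewrite -mulf_div divff // mulr1.
Qed.

(** The action for which invariance of [F] means invariance of [F(z) dz]. *)
Definition slash2 F g : C -> C := fun z => denom g z ^- 2 * F (mobius g z).

Lemma slash2M F g h z : \det g = 1 -> \det h = 1 -> upper_half z ->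
  slash2 F (g *m h) z = slash2 (slash2 F g) h z.
Proof.
move=> dg dh Hz; rewrite /slash2 mobiusM // denomM // exprMn invfM.
by rewrite mulrA [denom h z ^- 2 * _]mulrC.
Qed.

Lemma slash2_ext F F' g z : \det g = 1 -> (forall z, upper_half z -> F z = F' z) ->
  upper_half z -> slash2 F g z = slash2 F' g z.
Proof. by move=> dg FF Hz; rewrite /slash2 FF //; exact: mobius_upper. Qed.

Lemma SL2Z_det g : SL2Z g -> \det g = 1. Proof. by case. Qed.

Lemma SL2Z_mul g h : SL2Z g -> SL2Z h -> SL2Z (g *m h).
Proof.
move=> [dg ig] [dh ih]; split; first by rewrite det_mulmx dg dh mulr1.
by move=> i j; rewrite mulmx22 rpredD // rpredM.
Qed.

Lemma det1_unit g : \det g = 1 -> g \in unitmx.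
Proof. by move=> dg; rewrite unitmxE dg unitr1. Qed.

Lemma det_invmx1 g : \det g = 1 -> \det (invmx g) = 1.
Proof. by move=> dg; rewrite det_inv dg invr1. Qed.

Lemma invmx22 g : \det g = 1 -> invmx g = mx2 (g 1 1) (- g 0 1) (- g 1 0) (g 0 0).
Proof.
move=> dg; have gu := det1_unit dg.
apply: (can_inj (mulKmx gu)); rewrite mulmxV //.
have E := dg; rewrite det22 in E.
apply/matrixP => i j; rewrite mulmx22 !mxE /=.
case: i j => [[|[|//]] hi] [[|[|//]] hj]; rewrite ?(ord2_0 hi) ?(ord2_1 hi) ?(ord2_0 hj) ?(ord2_1 hj) /=.
- by rewrite -E; ring.
- by ring.
- by ring.
- by rewrite -E; ring.
Qed.

Lemma SL2Z_inv g : SL2Z g -> SL2Z (invmx g).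
Proof.
move=> [dg ig]; split; first exact: det_invmx1.
rewrite invmx22 // => i j; rewrite !mxE.
by case: ifP => _; case: ifP => _; rewrite ?rpredN.
Qed.

End WeightTwo.

Section Trace.
Variable R : realType.
Local Notation C := R[i].
Local Notation M2 := 'M[R]_2.
Implicit Types (z c : C) (g h : M2) (F : C -> C) (G : set M2).

(** [finite_index] speaks of left cosets; inverting their representatives
    produces the right cosets along which a trace is formed. *)
Lemma right_coset_reps (H K : set M2) : finite_index H K ->
  (forall g, K g -> g \in unitmx) -> (forall g, K g -> K (invmx g)) ->
  H `<=` K -> H 1%:M -> (forall g h, H g -> H h -> H (g *m h)) ->
  (forall g, H g -> H (invmx g)) ->
  exists n (rho : 'I_n -> M2),
   [/\ forall i, K (rho i),
       forall g, K g -> exists i h, H h /\ g = h *m rho i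
     & forall i j h, H h -> h *m rho i = rho j -> i = j].
Proof.
move=> fi Ku Kinv HK H1 Hmul Hinv.
have /finite_seqP[s0 s0E] := fi; pose s := undup s0.
have sE : [set` s] = [set [set g *m h | h in H] | g in K].
  by rewrite s0E; apply/seteqP; split=> X /=; rewrite mem_undup.
pose n := size s.
have /choice[r hr] (i : 'I_n) : exists g, K g /\ [set g *m h | h in H] = nth set0 s i.
  have : [set` s] (nth set0 s i) by rewrite /= mem_nth.
  by rewrite sE => -[g Kg gE]; exists g.
exists n, (fun i => invmx (r i)); split.
- by move=> i; apply: Kinv; exact: (hr i).1.
- move=> g Kg.
  have : [set` s] [set invmx g *m h | h in H] by rewrite sE; exists (invmx g) => //; exact: Kinv.
  move=> /= /(nthP set0)[i i_lt iE]; pose i' := Ordinal i_lt.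
  have [Kr rE] := hr i'.
  have : [set invmx g *m h | h in H] (r i').
    by rewrite -iE -[X in X (r i')]rE; exists 1%:M => //; rewrite mulmx1.
  move=> [h Hh hE]; exists i', h; split=> //.
  have -> : h = g *m r i' by rewrite -hE mulKVmx ?Ku.
  by rewrite mulmxK ?Ku.
- move=> i j h Hh hE.
  have [Ki iE] := hr i; have [Kj jE] := hr j.
  have rij : r i = r j *m h.
    by rewrite -[h](mulmxKV (Ku _ Ki)) hE mulmxA mulmxV ?Ku // mul1mx.
  apply/val_inj/eqP; rewrite -(nth_uniq set0 (ltn_ord i) (ltn_ord j) (undup_uniq _)).
  rewrite -iE -jE; apply/eqP/seteqP; split=> X [k Hk <-].
    by exists (h *m k); [exact: Hmul | rewrite rij mulmxA].
  exists (invmx h *m k); first by apply: Hmul => //; exact: Hinv.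
  by rewrite rij mulmxA mulmxK // Ku //; exact: HK.
Qed.

(** The trace, which is the sum of the translates of [F] along the cosets, is
    invariant under the modular group because right multiplication permutes the
    cosets; so [level_one_mean_eq0] applies to it. *)
Lemma trace_mean_eq0 (H : set M2) n (rho : 'I_n -> M2) F (c_ : 'I_n -> C) :
  H `<=` SL2Z -> H 1%:M -> (forall g h, H g -> H h -> H (g *m h)) ->
  (forall g, H g -> H (invmx g)) ->
  (forall i, SL2Z (rho i)) ->
  (forall g, SL2Z g -> exists i h, H h /\ g = h *m rho i) ->
  (forall i j h, H h -> h *m rho i = rho j -> i = j) ->
  (forall h z, H h -> upper_half z -> slash2 F h z = F z) ->
  (forall i, has_mean (slash2 F (rho i)) (c_ i)) -> \sum_(i < n) c_ i = 0.
Proof.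
move=> HS H1 Hmul Hinv Srho cover sep FH mF.
pose T z := \sum_(i < n) slash2 F (rho i) z.
have mT : has_mean T (\sum_(i < n) c_ i) by exact: has_mean_sum.
have TS g z : SL2Z g -> upper_half z -> slash2 T g z = T z.
  move=> Sg Hz.
  have /choice[sigma hsigma] i : exists j, exists h, H h /\ rho i *m g = h *m rho j.
    exact/cover/SL2Z_mul.
  have sigma_inj : injective sigma.
    move=> i j sij; have [h [Hh hE]] := hsigma i; have [k [Hk kE]] := hsigma j.
    have hu : k \in unitmx by exact/det1_unit/SL2Z_det/HS.
    have gu : g \in unitmx by exact/det1_unit/SL2Z_det.
    apply: (sep i j (k *m invmx h)); first by apply: Hmul => //; exact: Hinv.
    have hu' : h \in unitmx by exact/det1_unit/SL2Z_det/HS.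
    rewrite -[LHS](mulmxK gu) -!mulmxA [rho i *m (g *m _)]mulmxA hE -!mulmxA.
    by rewrite (mulKmx hu') mulmxA sij -kE mulmxK.
  rewrite {1}/slash2 {1}/T mulr_sumr [RHS](reindex_inj sigma_inj) /=.
  apply: eq_bigr => i _; have [h [Hh hE]] := hsigma i.
  rewrite -[LHS]/(slash2 (slash2 F (rho i)) g z) -slash2M ?hE //; try exact: SL2Z_det.
  rewrite slash2M //; try exact: SL2Z_det; last exact/SL2Z_det/HS.
  by apply: slash2_ext => // [|w Hw]; [exact: SL2Z_det | exact: FH].
apply: level_one_mean_eq0 mT => z Hz.
  have Sg : SL2Z (mx2 1 1 0 1 : M2).
    split; first by rewrite det22 !mxE /= mulr0 subr0 mulr1.
    by move=> i j; rewrite mxE; case: ifP; case: ifP; rewrite ?rpred0 ?rpred1.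
  rewrite -[RHS](TS _ _ Sg Hz) /slash2 /mobius /denom !mxE /=.
  by rewrite mul0r add0r expr1n invr1 !mul1r mulr1.
have Sg : SL2Z (mx2 0 (-1) 1 0 : M2).
  split; first by rewrite det22 !mxE /= mulr0 sub0r mulN1r opprK.
  by move=> i j; rewrite mxE; case: ifP; case: ifP; rewrite ?rpredN ?rpred0 ?rpred1.
rewrite -[RHS](TS _ _ Sg Hz) /slash2 /mobius /denom !mxE /=.
by rewrite mul0r add0r mul1r addr0 rmorphN rmorph1 mulN1r.
Qed.

(** An upper triangular [g] acts on the half-plane by an affine map whose slope
    [r = (g 0 0)^2] is also the factor of automorphy; [r] may be irrational. *)
Lemma slash2_upper_triangular F g c : \det g = 1 -> g 1 0 = 0 -> has_mean F c ->
  exists2 r : R, 0 < r & has_mean (slash2 F g) (r%:C * c).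
Proof.
move=> dg g10 mF; have := dg; rewrite det22 g10 mulr0 subr0 => E.
have a0 : g 0 0 != 0 by apply/eqP => a0; move: E; rewrite a0 mul0r => /eqP; rewrite eq_sym oner_eq0.
have dE : g 1 1 = (g 0 0)^-1 by rewrite -[RHS]mulr1 -E mulKf.
exists (g 0 0 ^+ 2); first by rewrite exprn_even_gt0.
have r0 : 0 < g 0 0 ^+ 2 by rewrite exprn_even_gt0.
apply: has_mean_ext (has_mean_affine (g 0 0 * g 0 1) r0 mF) => z Hz.
rewrite /slash2 /mobius /denom g10 mul0r add0r dE fmorphV exprVn invrK invrK rmorphXn /=.
by congr (_ * F _); rewrite rmorphM /= ; ring.
Qed.

Lemma mobius_P1_upper_triangular g h : \det g = 1 -> \det h = 1 ->
  mobius_P1 g None = mobius_P1 h None -> (invmx g *m h) 1 0 = 0.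
Proof.
move=> dg dh; rewrite mulmx22 invmx22 // !mxE /=.
case: eqP => [g0|/eqP g0]; case: eqP => [h0|/eqP h0] // E.
  by rewrite g0 h0 oppr0 mul0r mulr0 addr0.
case: E => /eqP; rewrite eqr_div // => /eqP E.
by rewrite mulNr addrC E mulrC subrr.
Qed.

(** The residue theorem: with the residues at all other cusps equal to [0], the
    residue at infinity is [0] too, because the translates by representatives
    sending infinity into its own orbit contribute positive multiples of it. *)
Theorem residue_infinity_eq0 G F c : commensurable G ->
  (forall g z, G g -> upper_half z -> slash2 F g z = F z) -> has_mean F c ->
  (forall g, SL2Z g -> ~ orbit_P1 G None (mobius_P1 g None) -> has_mean (slash2 F g) 0) ->
  c = 0.
Proof.
move=> [[Gdet G1 Gmul Ginv] _ fi] FG mF m0.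
pose H := G `&` SL2Z.
have HS : H `<=` SL2Z by move=> g [].
have S1 : SL2Z (1%:M : M2).
  by split; [exact: det1 | move=> i j; rewrite mxE; case: eqP; rewrite ?rpred0 ?rpred1].
have H1 : H 1%:M by [].
have Hmul g h : H g -> H h -> H (g *m h).
  by move=> [Gg Sg] [Gh Sh]; split; [exact: Gmul | exact: SL2Z_mul].
have Hinv g : H g -> H (invmx g).
  by move=> [Gg Sg]; split; [exact: Ginv | exact: SL2Z_inv].
have [||n [rho [Srho cover sep]]] := right_coset_reps fi _ _ HS H1 Hmul Hinv.
- by move=> g Sg; exact/det1_unit/SL2Z_det.
- by move=> g; exact: SL2Z_inv.
have /choice[r hr] i : exists r : R, [/\ 0 <= r, orbit_P1 G None (mobius_P1 (rho i) None) -> 0 < r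
    & has_mean (slash2 F (rho i)) (r%:C * c)].
  have drho := SL2Z_det (Srho i).
  have [[g Gg gE]|no] := pselect (orbit_P1 G None (mobius_P1 (rho i) None)); last first.
    by exists 0; split=> //; rewrite rmorph0 mul0r; exact: m0.
  have dg : \det g = 1 by exact: Gdet.
  have dd : \det (invmx g *m rho i) = 1 by rewrite det_mulmx det_invmx1 // drho mulr1.
  have [r r0 hr] := slash2_upper_triangular dd (mobius_P1_upper_triangular dg drho gE) mF.
  exists r; split=> //; first exact: ltW.
  apply: has_mean_ext hr => z Hz.
  rewrite -[in RHS](mulKVmx (det1_unit dg) (rho i)) [RHS]slash2M //.
  by apply: slash2_ext => // w Hw; rewrite FG.
have sum0 : \sum_(i < n) (r i)%:C * c = 0.
  apply: (trace_mean_eq0 HS H1 Hmul Hinv Srho cover sep) => [h z [Gh _]|i]; first exact: FG.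
  by have [] := hr i.
move: sum0; rewrite -mulr_suml -rmorph_sum /= => /eqP; rewrite mulf_eq0 fmorph_eq0.
suff s0 : 0 < \sum_(i < n) r i by rewrite gt_eqF //= => /eqP.
have [i [h [[Gh _] hE]]] := cover _ S1.
rewrite (bigD1 i) //= ltr_pwDl //; last by apply: sumr_ge0 => j _; have [] := hr j.
have [_ + _] := hr i; apply; exists (rho i) => //.
have -> : rho i = invmx h.
  by rewrite -[LHS]mul1mx -[1%:M](mulVmx (det1_unit (Gdet _ Gh))) -mulmxA -hE mulmx1.
exact: Ginv.
Qed.

End Trace.

(** * Products of dual modular forms *)

Section DualProduct.
Variable R : realType.
Local Notation C := R[i].
Local Notation M2 := 'M[R]_2.
Implicit Types (z c : C) (g h : M2) (f : C -> C) (G : set M2) (kk : int).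

Lemma autj_det1 g z : \det g = 1 -> autj g z = denom g z.
Proof. by move=> dg; rewrite /autj dg sqrtr1 invr1 rmorph1 mul1r. Qed.

Lemma autjk_dual kk g z : \det g = 1 -> upper_half z ->
  autjk kk g z * autjk (4 - kk) g z = denom g z ^+ 2.
Proof.
move=> dg Hz; have s0 : sqrtc (autj g z) != 0 by rewrite sqrtc_eq0 autj_det1 // denom_neq0.
rewrite /autjk -expfzDr // addrC subrK -[4]/(Posz (2 * 2)) -exprnP exprM sqr_sqrtc.
by rewrite autj_det1.
Qed.

Lemma slash_dual kk f f' g z : \det g = 1 -> upper_half z ->
  slash kk f g z * slash (4 - kk) f' g z = slash2 (fun w => f w * f' w) g z.
Proof.
by move=> dg Hz; rewrite /slash /slash2 mulrACA -invfM autjk_dual.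
Qed.

Lemma ncXz z kk : nc (z ^ kk) = nc z ^ kk.
Proof.
have aux n : nc (z ^+ n) = nc z ^+ n.
  by elim: n => [|n IH]; rewrite ?expr0 ?nc1 // !exprS ncM IH.
by case: kk => n; rewrite ?NegzE -?exprnN -?exprnP ?ncV ?aux.
Qed.

(** The norm condition on the pairs attached to the multiplier compares
    [nu g * autjk kk g z] with the modulus that [autjk kk g z] has already. *)
Lemma nc_multiplier G kk nu g : (forall g, G g -> \det g = 1) ->
  consistent_multiplier G kk nu -> G g -> nc (nu g) = 1.
Proof.
move=> Gdet [_ [Sin _ _ _] _] Gg; have dg := Gdet g Gg.
have Hi : upper_half ('i%C : C) by rewrite /upper_half /=.
have [_ _ /(_ _ Hi) E] := Sin (g, fun z => nu g * autjk kk g z) (conj Gg (fun z _ => erefl)).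
have {E} : nc (nu g * autjk kk g 'i%C) = nc (denom g 'i%C) `^ (kk%:~R / 2).
  by move: E; rewrite -[(_, _).1]/g dg powR1 mul1r.
rewrite ncM /autjk ncXz autj_det1 //.
have D0 : 0 < nc (denom g 'i%C) by rewrite nc_gt0 denom_neq0.
set x := nc (sqrtc _).
have xx : nc (denom g 'i%C) = x `^ 2.
  by rewrite -[X in nc X = _]sqr_sqrtc expr2 ncM -expr2 -powR_mulrn ?nc_ge0.
have x0 : 0 < x by rewrite nc_gt0 sqrtc_eq0 -nc_gt0.
have xk : 0 < x ^ kk by rewrite exprz_gt0.
rewrite xx -powRrM (_ : 2 * (kk%:~R / 2) = kk%:~R); last by field.
rewrite powR_intmul ?(ltW x0) //.
by rewrite -[RHS]mul1r => /(mulIf (lt0r_neq0 xk)).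
Qed.

Lemma mul_conj_mult G kk nu g : (forall g, G g -> \det g = 1) ->
  consistent_multiplier G kk nu -> G g -> nu g * conj_mult nu g = 1.
Proof.
move=> Gdet hnu Gg; rewrite -[conj_mult nu g]/(conjc (nu g)) -sqr_normc normC_nc.
by rewrite (nc_multiplier Gdet hnu Gg) expr1n.
Qed.

(** The multipliers [nu] and its conjugate cancel, and the weights [k] and
    [2 - k] add up to [2]. *)
Lemma modular_dual G kk nu f f' : (forall g, G g -> \det g = 1) ->
  consistent_multiplier G kk nu ->
  modular G kk nu f -> modular G (4 - kk) (conj_mult nu) f' ->
  forall g z, G g -> upper_half z -> slash2 (fun w => f w * f' w) g z = f z * f' z.
Proof.
move=> Gdet hnu mf mf' g z Gg Hz; rewrite /slash2 mf // mf' //.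
have dg := Gdet g Gg; have D0 := denom_neq0 dg Hz.
rewrite (_ : _ * _ * _ * _ = (nu g * conj_mult nu g) *
  (autjk kk g z * autjk (4 - kk) g z) * (f z * f' z)); last by ring.
by rewrite (mul_conj_mult Gdet hnu Gg) autjk_dual // mul1r mulKf // expf_neq0.
Qed.

Lemma clim_series0 : clim (series (fun=> 0 : C)) 0.
Proof.
apply: (clim_ext (N := 0%N) (u := fun=> 0)); last exact: clim_cst.
by move=> n _; rewrite /series /= big1.
Qed.

(** All exponents of the product are positive, with a positive lower bound. *)
Lemma qexp_mean0 (i j : nat) f f' : (0 < i + j)%N -> qexp_from i f -> qexp_from j f' ->
  has_mean (fun z => f z * f' z) 0.
Proof.
move=> ij [N [N0 [a ha]]] [N' [N'0 [b hb]]].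
have n0 : 0 < N%:R :> R by rewrite ltr0n.
have n'0 : 0 < N'%:R :> R by rewrite ltr0n.
have ari (k P : nat) : (0 < P)%N -> is_arithmetic (fun n : nat => ((Posz k + n%:Z)%:~R / P%:R) : R).
  move=> P0; exists (k%:R / P%:R), P%:R^-1; split; first by rewrite invr_gt0 ltr0n.
  by move=> n; rewrite -PoszD -pmulrn natrD mulrDl [_^-1 * _]mulrC.
have pos (n m : nat) : 1 <= (N%:R + N'%:R) * ((Posz i + n%:Z)%:~R / N%:R + (Posz j + m%:Z)%:~R / N'%:R) :> R.
  rewrite -!PoszD -!pmulrn.
  have h1 : 0 <= N'%:R * ((i + n)%:R / N%:R) :> R by rewrite mulr_ge0 // divr_ge0.
  have h2 : 0 <= N%:R * ((j + m)%:R / N'%:R) :> R by rewrite mulr_ge0 // divr_ge0.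
  rewrite (_ : _ * _ = (i + n)%:R + (j + m)%:R + (N'%:R * ((i + n)%:R / N%:R) + N%:R * ((j + m)%:R / N'%:R))).
    apply: ler_wpDr; first exact: addr_ge0.
    by rewrite -natrD ler1n addnACA addn_gt0 ij.
  by field; rewrite !gt_eqF.
have K0 : 0 <= N%:R + N'%:R :> R by rewrite addr_ge0.
have ne0 (n m : nat) : ((Posz i + n%:Z)%:~R / N%:R + (Posz j + m%:Z)%:~R / N'%:R == 0 :> R) = false.
  by apply/eqP => E; have := pos n m; rewrite E mulr0 ler10.
have [|n|c [hc mc]] := mean_qseriesM (d := fun=> 0) K0 (ari i N N0) (ari j N' N'0)
  (fun z Hz => clim_cvg (ha z Hz)) (fun z Hz => clim_cvg (hb z Hz)).
- by move=> n m; right; apply: le_trans (pos n m) _; rewrite ler_wpM2l // ler_norm.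
- by apply: (clim_ext (N := 0%N)) clim_series0 => p _; apply: eq_bigr => m _; rewrite ne0 mulr0.
suff <- : c = 0 by [].
apply: clim_uniq hc _.
by apply: (clim_ext (N := 0%N)) clim_series0 => p _; apply: eq_bigr => m _; rewrite mulr0.
Qed.

End DualProduct.

(** * Expansions at infinity *)

Section Expansions.
Variable R : realType.
Local Notation C := R[i].
Local Notation M2 := 'M[R]_2.
Implicit Types (z c : C) (f g : C -> C) (G : set M2) (kk : int) (A B : R -> C).

Lemma clim_series1 (u : nat -> C) k : (forall n, n != k -> u n = 0) -> clim (series u) (u k).
Proof.
move=> u0; apply: (clim_ext (N := k.+1) (u := fun=> u k)); last exact: clim_cst.
move=> n kn; rewrite /series /= (bigD1_seq k) ?mem_index_iota ?iota_uniq //=.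
by rewrite big1 ?addr0 // => i /u0.
Qed.

Lemma is_arithmetic_inj (x : nat -> R) : is_arithmetic x -> injective x.
Proof.
move=> [x0 [d [d0 hx]]] n m; rewrite !hx => /addrI /(mulfI (lt0r_neq0 d0)) /eqP.
by rewrite eqr_nat => /eqP.
Qed.

Lemma coefficient_clim A (x : nat -> R) (s : R) : is_arithmetic x ->
  (forall t, A t != 0 -> exists n, t = x n) ->
  clim (series (fun n => A (x n) * (s + x n == 0)%:R)) (A (- s)).
Proof.
move=> ax sA.
have [[k sk]|no] := pselect (exists k, - s = x k).
  have := @clim_series1 (fun n => A (x n) * (s + x n == 0)%:R) k.
  rewrite -sk subrr eqxx mulr1; apply => n nk; rewrite addr_eq0 eq_sym eqr_oppLR sk.
  by rewrite (inj_eq (is_arithmetic_inj ax)) (negPf nk) mulr0.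
rewrite (_ : A (- s) = 0); last first.
  by apply/eqP; apply: contraT => /sA[k sk]; case: no; exists k.
apply: (clim_ext (N := 0%N)) (@clim_series0 R) => p _; apply: eq_bigr => n _.
rewrite addr_eq0 eq_sym eqr_oppLR; case: eqP => [sn|]; last by rewrite mulr0.
by case: no; exists n.
Qed.

(** The nonzero elements of a translate of the integers stay away from [0].
    This provides the bound on denominators required by termwise integration
    without any relation between the shifts of the two expansions. *)
Lemma integer_translate_gap (theta : R) :
  exists2 K : R, 0 <= K & forall k : int, k%:~R + theta = 0 \/ 1 <= K * `|k%:~R + theta|.
Proof.
pose j := Num.floor theta; pose t := theta - j%:~R.
have E k : k%:~R + theta = (k + j)%:~R + t by rewrite /t intrD; ring.
have t0 : 0 <= t by rewrite subr_ge0 floor_le.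
have t1 : t < 1 by rewrite ltrBlDl -intrD1 floorD1_gt.
have [tz|tn] := eqVneq t 0.
  exists 1 => // k; rewrite E tz addr0 mul1r -intr_norm.
  have [->|kj] := eqVneq (k + j) 0; first by left.
  by right; rewrite ler1z; rewrite -gtz0_ge1 normr_gt0.
have tp : 0 < t by rewrite lt_neqAle eq_sym tn.
have s0 : 0 < 1 - t by rewrite subr_gt0.
exists (t^-1 + (1 - t)^-1); first by rewrite addr_ge0 // invr_ge0 ltW.
move=> k; right; rewrite E mulrDl.
have [k0|k0] := lerP 0 (k + j).
  have k0' : 0 <= (k + j)%:~R :> R by rewrite ler0z.
  apply: ler_wpDr; first by rewrite mulr_ge0 // invr_ge0 ltW.
  by rewrite ler_pdivlMl // mulr1; apply: le_trans (ler_norm _); rewrite lerDr.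
have k0' : (k + j)%:~R <= -1 :> R.
  have : (k + j + 1)%:~R <= 0 :> R by rewrite lerz0 lezD1.
  by rewrite intrD; lra.
apply: ler_wpDl; first by rewrite mulr_ge0 // invr_ge0 ltW.
rewrite ler_pdivlMl // mulr1 ler0_norm; lra.
Qed.

(** An expansion in which the coefficient is a function of the exponent, as in
    [expansion_infty], with the exponents listed from the leading one. *)
Definition lattice_series (w : R) f A : Prop := exists (theta : R) (x : nat -> R),
  [/\ forall n, x n = (n%:R + theta) / w,
      qseries f (A \o x) x & forall t, A t != 0 -> exists n, t = x n].

Lemma lattice_arithmetic (w theta : R) (x : nat -> R) : 0 < w ->
  (forall n, x n = (n%:R + theta) / w) -> is_arithmetic x.
Proof.
move=> w0 hx; exists (theta / w), w^-1; split; first by rewrite invr_gt0.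
by move=> n; rewrite hx; ring.
Qed.

Lemma lattice_gap (w theta : R) : 0 < w ->
  exists2 K : R, 0 <= K & forall k : int,
    (k%:~R + theta) / w = 0 \/ 1 <= K * `|(k%:~R + theta) / w|.
Proof.
move=> w0; have [K K0 hK] := integer_translate_gap theta.
exists (K * w); first by rewrite mulr_ge0 // ltW.
move=> k; have [->|h] := hK k; first by left; rewrite mul0r.
right; rewrite normrM normfV (gtr0_norm w0).
by rewrite -mulrA [w * _]mulrC divfK // gt_eqF.
Qed.

Lemma mean_lattice_two_terms (w : R) f g A B (p q : R) : 0 < w -> p != q ->
  lattice_series w f A -> lattice_series w g B ->
  (forall t, t != p -> t != q -> A t * B (- t) = 0) ->
  has_mean (fun z => f z * g z) (A p * B (- p) + A q * B (- q)).
Proof.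
move=> w0 pq [th [x [hx hf sA]]] [th' [y [hy hg sB]]] AB0.
have ax := lattice_arithmetic w0 hx; have ay := lattice_arithmetic w0 hy.
have [K K0 hK] := lattice_gap (th + th') w0.
have [n m|n|c [hc mc]] := mean_qseriesM (d := fun n => B (- x n)) K0 ax ay hf hg.
- rewrite (_ : x n + y m = ((Posz n + Posz m)%:~R + (th + th')) / w); first exact: hK.
  by rewrite hx hy -PoszD -pmulrn natrD; ring.
- exact: coefficient_clim.
suff <- : c = A p * B (- p) + A q * B (- q) by [].
apply: clim_uniq hc _; pose D t := A t * B (- t).
have sD t : D t != 0 -> exists n, t = x n.
  by move=> Dt; apply: sA; apply: contraNneq Dt => At; rewrite /D At mul0r.
have := climD (coefficient_clim (- p) ax sD) (coefficient_clim (- q) ax sD).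
rewrite !opprK; apply: (clim_ext (N := 0%N)) => N _.
rewrite /series /= -big_split /=; apply: eq_bigr => n _.
rewrite ![- _ + _]addrC !subr_eq0 -mulrDr.
have [->|xp] := eqVneq (x n) p; first by rewrite (negPf pq) addr0 mulr1.
have [->|xq] := eqVneq (x n) q; first by rewrite add0r mulr1.
by rewrite AB0 // addr0 mulr0.
Qed.

Lemma is_width_le G (w w' : R) : is_width G w -> is_width G w' -> w' <= w.
Proof.
move=> [w0 hw] [w'0 hw'].
have [n wn] : exists n : int, w = n%:~R * w' by apply/hw'/hw; exists 1; rewrite mul1r.
have : 0 < n%:~R :> R by rewrite -(pmulr_lgt0 _ w'0) -wn.
by rewrite ltr0z gtz0_ge1 -(ler1z R) wn => n1; rewrite ler_peMl // ltW.
Qed.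

Lemma is_width_uniq G (w w' : R) : is_width G w -> is_width G w' -> w = w'.
Proof. by move=> h h'; apply/eqP; rewrite eq_le !(is_width_le (G := G)). Qed.

Lemma cos_2pi_eq1 (t : R) : 0 <= t < 1 -> cos (2 * pi * t) = 1 -> t = 0.
Proof.
move=> /andP[t0 t1]; have pi0 := pi_gt0 R.
rewrite (_ : 2 * pi * t = pi * t + pi * t); last by ring.
rewrite cosD => E; have := cos2Dsin2 (pi * t) => E'.
apply/eqP; apply: contraT => tn.
have tp : 0 < t by rewrite lt_neqAle eq_sym tn.
have : 0 < sin (pi * t) by rewrite sin_gt0_pi // mulr_gt0 //= gtr_pMr.
nra.
Qed.

Lemma is_shift_uniq G kk nu (w s s' : R) :
  is_shift G kk nu w s -> is_shift G kk nu w s' -> s = s'.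
Proof.
move=> [/andP[s0 s1] h1 h2] [/andP[s'0 s'1] h1' h2'].
have : cexp ((2 * pi * s)%:C * 'i%C) = cexp ((2 * pi * s')%:C * 'i%C).
  by have [T|T] := pselect (G (mx2 1 w 0 1)); [rewrite h1 // h1' | rewrite h2 // h2'].
have cE (r : R) : cexp (r%:C * 'i%C) = cos r +i* sin r.
  by rewrite /cexp /= !(mulr0, mul0r, mulr1, subrr, addr0) expR0 mul1r.
rewrite !cE => -[Ec Es].
wlog ss : s s' s0 s1 s'0 s'1 {h1 h2 h1' h2'} Ec Es / s <= s'.
  by move=> H; have [|/ltW] := lerP s s' => h; [exact: H | apply/esym; exact: H].
suff : s' - s = 0 by move/eqP; rewrite subr_eq0 => /eqP.
apply: cos_2pi_eq1; first by apply/andP; split; lra.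
rewrite mulrBr cosB Ec Es -!expr2; exact: cos2Dsin2.
Qed.

(** Uniqueness of the width and of the shift is what places an arbitrary element
    of [exponents] on the progression used by the given expansion. *)
Lemma expansion_lattice G kk nu f A : expansion_infty G kk nu f A ->
  exists w, is_width G w /\ lattice_series w f A.
Proof.
move=> [A0 [w [s [hw hs [n0 [An hf]]]]]]; exists w; split=> //.
exists (n0%:~R + s), (fun n => ((n0 + n%:Z)%:~R + s) / w); split.
- by move=> n; rewrite intrD -pmulrn; congr (_ / _); ring.
- by move=> z Hz; exact: clim_cvg (hf z Hz).
move=> t At.
have [[w' [s' [hw' hs' [k tE]]]]|no] := pselect (exponents G kk nu t); last first.
  by rewrite A0 ?eqxx in At.
have ww := is_width_uniq hw' hw; subst w'.
have ss := is_shift_uniq hs' hs; subst s'.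
have [kn|kn] := ltrP k n0.
  by case/eqP: At; rewrite tE; exact: An.
exists (`|k - n0|)%N; rewrite tE abszE ger0_norm ?subr_ge0 //.
by rewrite [n0 + _]addrC subrK.
Qed.

End Expansions.

(** * The index sets *)

Section IndexSets.
Variable R : realType.
Local Notation C := R[i].
Local Notation M2 := 'M[R]_2.
Implicit Types (z : C) (f g : C -> C) (G : set M2) (kk : int) (nu : M2 -> C).
Implicit Types (U : set (set (option R))).

Lemma weight_dualK kk : 4 - (4 - kk) = kk.
Proof. by rewrite subKr. Qed.

Lemma conj_multK nu : conj_mult (conj_mult nu) = nu.
Proof. by apply/funext => g; rewrite /conj_mult conjcK. Qed.

Lemma cocuspsK G U : U `<=` cusps G -> cocusps G (cocusps G U) = U.
Proof. by move=> UG; rewrite /cocusps setDD; apply/setIidPr. Qed.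

Lemma mobius_P1_1 (x : option R) : mobius_P1 (1%:M : M2) x = x.
Proof.
case: x => [t|] /=; rewrite !mxE /= ?eqxx //.
by rewrite mul0r add0r oner_eq0 mul1r addr0 divr1.
Qed.

Lemma orbit_P1_refl G x : G 1%:M -> orbit_P1 G x x.
Proof. by move=> G1; exists 1%:M => //; exact: mobius_P1_1. Qed.

Lemma cusps_infty G : cusps G (cusp_infty G).
Proof. by exists None. Qed.

Lemma slash1 kk f z : upper_half z -> slash kk f (1%:M) z = f z.
Proof.
move=> Hz; rewrite /slash /autjk autj_det1 ?det1 // /mobius /denom !mxE /=.
by rewrite mul0r add0r sqrtc1 exp1rz invr1 !mul1r addr0 mulr1.
Qed.

Lemma qexp_from_ext (n0 : int) f g : (forall z, upper_half z -> f z = g z) ->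
  qexp_from n0 f -> qexp_from n0 g.
Proof.
move=> fg [N [N0 [a ha]]]; exists N; split=> //; exists a => z Hz.
by rewrite -fg //; exact: ha.
Qed.

Lemma at_cusp_infty_qexp (n0 : int) G kk f : G 1%:M ->
  at_cusp (qexp_from n0) kk f (cusp_infty G) -> qexp_from n0 f.
Proof.
move=> G1 /(_ 1%:M) H; apply: (@qexp_from_ext _ (slash kk f 1%:M)) => [z|].
  exact: slash1.
apply: H; last by rewrite mobius_P1_1; exact: orbit_P1_refl.
by split; [exact: det1 | move=> i j; rewrite mxE; case: eqP; rewrite ?rpred0 ?rpred1].
Qed.

(** The coefficient at [r] is the mean of [q^(-r) f], hence does not depend on
    the expansion from which it is read; if [r] were below the first exponent
    [i / N] of the second expansion, that mean would be [0]. *)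
Lemma order_ge_qexp G kk nu f A (r : R) (i : nat) :
  expansion_infty G kk nu f A -> A r != 0 -> qexp_from i f ->
  exists2 N : R, 0 < N & i%:R / N <= r.
Proof.
move=> /expansion_lattice[w [[w0 _] [th [x [hx hf sA]]]]] Ar [N [N0 [b hb]]].
have n0 : 0 < N%:R :> R by rewrite ltr0n.
exists N%:R => //; rewrite leNgt; apply/negP => ri.
have [K K0 hK] := lattice_gap (th - r * w) w0.
have [n|c [hc mc]] := mean_qpow_qseries (s := - r) K0 (lattice_arithmetic w0 hx) hf.
  rewrite (_ : - r + x n = (n%:Z%:~R + (th - r * w)) / w); first exact: hK.
  by rewrite hx -pmulrn; field; rewrite gt_eqF.
have cr : c = A r.
  apply: (clim_uniq hc); rewrite -[r in A r]opprK.
  by apply: coefficient_clim sA; exact: lattice_arithmetic hx.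
pose y (n : nat) : R := (Posz i + n%:Z)%:~R / N%:R.
have ay : is_arithmetic y.
  exists (i%:R / N%:R), N%:R^-1; split; first by rewrite invr_gt0.
  by move=> n; rewrite /y -PoszD -pmulrn natrD mulrDl [_^-1 * _]mulrC.
have hf' : qseries f b y by move=> z Hz; exact: clim_cvg (hb z Hz).
pose d := i%:R / N%:R - r; have d0 : 0 < d by rewrite subr_gt0.
have dy n : d <= - r + y n.
  rewrite addrC lerD2r /y -PoszD -pmulrn ler_pdivlMr // divfK ?gt_eqF //.
  by rewrite ler_nat leq_addr.
have K'0 : 0 <= d^-1 by rewrite invr_ge0 ltW.
have [n|c' [hc' mc']] := mean_qpow_qseries (s := - r) K'0 ay hf'.
  right; rewrite ler_pdivlMl // mulr1; apply: le_trans (dy n) _; exact: ler_norm.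
have c'0 : c' = 0.
  apply: (clim_uniq hc'); apply: (clim_ext (N := 0%N)) (@clim_series0 R) => p _.
  apply: eq_bigr => n _; rewrite gt_eqF ?mulr0 //; exact: lt_le_trans (dy n).
move/eqP: Ar; apply; rewrite -cr -c'0.
exact: has_mean_uniq (mean_bound_mean mc) (mean_bound_mean mc').
Qed.

Lemma order_set_ge0 G kk nu U (r : R) : G 1%:M -> Defs.order_set G kk nu U r -> 0 <= r.
Proof.
move=> G1 [f [[[_ hol] _] _ [A [hA Ar _]]]].
have hf := at_cusp_infty_qexp G1 (hol _ (cusps_infty _)).
have [N N0] := order_ge_qexp (i := 0%N) hA Ar hf.
by rewrite mul0r.
Qed.

Lemma order_set_gt0 G kk nu U (r : R) : G 1%:M -> U (cusp_infty G) ->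
  Defs.order_set G kk nu U r -> 0 < r.
Proof.
move=> G1 Uoo [f [[_ van] _ [A [hA Ar _]]]].
have hf := at_cusp_infty_qexp G1 (van _ Uoo).
have [N N0] := order_ge_qexp (i := 1%N) hA Ar hf.
by apply: lt_le_trans; rewrite divr_gt0.
Qed.

Section Duality.
Variables (G : set M2) (kk : int) (nu : M2 -> C) (U : set (set (option R))).
Hypotheses (G1 : G 1%:M) (UG : U `<=` cusps G).
Local Notation I := (index_set G kk nu U).
Local Notation I' := (index_set G (4 - kk) (conj_mult nu) (cocusps G U)).
Local Notation ord := (Defs.order_set G kk nu U).
Local Notation ord' := (Defs.order_set G (4 - kk) (conj_mult nu) (cocusps G U)).

Lemma index_setE (m : R) : I m <->
  [/\ exponents G (4 - kk) (conj_mult nu) m,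
      U (cusp_infty G) -> 0 <= m & ~ U (cusp_infty G) -> 0 < m] /\ ~ ord' m \/
  ord (- m) /\ ~ ord' m.
Proof.
split; first by move=> [[[h1 [h2 h3]]|[r hr <-]] h4]; [left | right]; rewrite ?opprK.
move=> [[[h1 h2 h3] h4]|[h1 h2]]; split=> //; first by left.
by right; exists (- m) => //; rewrite opprK.
Qed.

Lemma dual_index_setE (m : R) : I' m <->
  [/\ exponents G kk nu m,
      U (cusp_infty G) -> 0 < m & ~ U (cusp_infty G) -> 0 <= m] /\ ~ ord m \/
  ord' (- m) /\ ~ ord m.
Proof.
rewrite /index_set /gap_set weight_dualK conj_multK -/(cocusps G (cocusps G U)) cocuspsK //.
have cU : cocusps G U (cusp_infty G) <-> ~ U (cusp_infty G).
  by split=> [[]//|nU]; split=> //; exact: cusps_infty.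
split.
  move=> [[[h1 [/= h2 h3]]|[r hr <-]] h4]; [left | right]; rewrite ?opprK //.
  split=> //; split=> // [Uoo|nU]; first by apply: h3 => /cU.
  exact/h2/cU.
move=> [[[h1 h2 h3] h4]|[h1 h2]]; split=> //.
  left; split=> //; split=> [/cU//|nU].
  by apply: h2; have [//|/cU] := pselect (U (cusp_infty G)).
by right; exists (- m) => //; rewrite opprK.
Qed.

(** Orders are nonnegative, so both would be [0]; but infinity lies in [U] or in
    its complement, and one of the two orders is then positive. *)
Lemma orders_not_opposite (x : R) : ord x -> ~ ord' (- x).
Proof.
move=> ox ox'; have x0 := order_set_ge0 G1 ox; have x0' := order_set_ge0 G1 ox'.
have [Uoo|nU] := pselect (U (cusp_infty G)).
  have := order_set_gt0 G1 Uoo ox; lra.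
have cU : cocusps G U (cusp_infty G) by split=> //; exact: cusps_infty.
have := order_set_gt0 G1 cU ox'; lra.
Qed.

Lemma index_sets_disjoint (m : R) : I m -> ~ I' (- m).
Proof.
move=> /index_setE Im /dual_index_setE; rewrite opprK => Im'.
case: Im => -[h1 h2]; case: Im' => -[h3 h4] //.
have [Uoo|nU] := pselect (U (cusp_infty G)).
  case: h1 h3 => [_ /(_ Uoo) a _] [_ /(_ Uoo) b _]; lra.
case: h1 h3 => [_ _ /(_ nU) a] [_ _ /(_ nU) b]; lra.
Qed.

Lemma index_sets_cover (x : R) : exponents G kk nu x ->
  exponents G (4 - kk) (conj_mult nu) (- x) -> I (- x) \/ I' x.
Proof.
move=> ex ex'.
have [Z|nZ] := pselect (ord' (- x)).
  right; apply/dual_index_setE; right; split=> //.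
  by move=> /orders_not_opposite.
have [Z|nZ'] := pselect (ord x).
  by left; apply/index_setE; right; rewrite opprK.
have [Uoo|nU] := pselect (U (cusp_infty G)).
  have [x0|x0] := lerP x 0.
    by left; apply/index_setE; left; split=> //; split=> // _; rewrite oppr_ge0.
  by right; apply/dual_index_setE; left; split=> //; split.
have [x0|x0] := lerP 0 x.
  by right; apply/dual_index_setE; left; split=> //; split.
by left; apply/index_setE; left; split=> //; split=> // _; rewrite oppr_gt0.
Qed.

End Duality.
End IndexSets.

(** * Zagier duality *)

Section Grid.
Variable R : realType.
Local Notation C := R[i].
Local Notation M2 := 'M[R]_2.

Lemma SL2Z_cusp (g : M2) : SL2Z g -> P1Q (mobius_P1 g None).
Proof.
move=> [_ ig]; rewrite /mobius_P1; case: eqP => //= _.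
have /intrP[a ->] := ig 0 0; have /intrP[c ->] := ig 1 0.
by exists (a%:~R / c%:~R); rewrite fmorph_div /= !ratr_int.
Qed.

(** At a cusp other than infinity one factor vanishes and the other is
    holomorphic, so that the product vanishes there. *)
Lemma dual_product_other_cusps (G : set M2) kk nu U (f g : C -> C) (h : M2) : G 1%:M ->
  modular_forms_pole_infty G kk nu U f ->
  modular_forms_pole_infty G (4 - kk) (conj_mult nu) (cocusps G U) g ->
  SL2Z h -> ~ orbit_P1 G None (mobius_P1 h None) ->
  has_mean (slash2 (fun z => f z * g z) h) 0.
Proof.
move=> G1 [_ holf vanf] [_ holg vang] Sh no.
pose c := orbit_P1 G (mobius_P1 h None).
have hc : c (mobius_P1 h None) by exact: orbit_P1_refl.
have cG : cusps G c by exists (mobius_P1 h None) => //; exact: SL2Z_cusp.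
have coo : c <> cusp_infty G by move=> E; apply: no; rewrite -/(cusp_infty G) -E.
apply: (@has_mean_ext _ (fun z => slash kk f h z * slash (4 - kk) g h z)) => [z Hz|].
  by apply: slash_dual => //; exact: SL2Z_det.
have [Uc|nUc] := pselect (U c).
  apply: (@qexp_mean0 _ 1 0) => //; first exact: (vanf c).
  exact: (holg c).
apply: (@qexp_mean0 _ 0 1) => //; first exact: (holf c).
exact: (vang c).
Qed.

End Grid.

Theorem theorem5p2 (R : realType) (G : set 'M[R]_2) (kk : int)
    (nu : 'M[R]_2 -> R[i]) (U : set (set (option R)))
    (hG : commensurable G)
    (hnu : consistent_multiplier G kk nu) (hfin : finite_multiplier G nu)
    (hU : U `<=` cusps G)
    (f : R -> R[i] -> R[i]) (a : R -> R -> R[i])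
    (hf : canonical_basis G kk nu U f a)
    (g : R -> R[i] -> R[i]) (b : R -> R -> R[i])
    (hg : canonical_basis G (4 - kk) (conj_mult nu) (cusps G `\` U) g b)
    (m n : R) (hm : index_set G kk nu U m)
    (hn : index_set G (4 - kk) (conj_mult nu) (cusps G `\` U) n) :
  a m n = - b n m.
Proof.
have [[Gdet G1 _ _] _ _] := hG.
have [/(_ m hm)[ff [a0 af]] _ _ _] := hf.
have [/(_ n hn)[gg [b0 bg]] _ _ _] := hg.
have [w [hw la]] := expansion_lattice af.
have [w' [hw' lb]] := expansion_lattice bg.
have ww := is_width_uniq hw' hw; subst w'.
have w0 : 0 < w by case: hw.
have nm : n != - m.
  by apply/eqP => E; case: (index_sets_disjoint hU hm); rewrite -E.
pose A t : R[i] := (t == - m)%:R + a m t.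
pose B t : R[i] := (t == - n)%:R + b n t.
have mn : m != - n by rewrite eq_sym eqr_oppLR.
have Am : A (- m) = 1 by rewrite /A eqxx a0 ?addr0 //; rewrite opprK => -[].
have Bn : B (- n) = 1 by rewrite /B eqxx b0 ?addr0 //; rewrite opprK => -[].
have An : A n = a m n by rewrite /A (negPf nm) add0r.
have Bm : B m = b n m by rewrite /B (negPf mn) add0r.
apply/eqP; rewrite -addr_eq0 addrC; apply/eqP.
apply: (residue_infinity_eq0 hG (F := fun z => f m z * g n z)).
- have [[mf _ _] _ _] := ff; have [[mg _ _] _ _] := gg.
  exact: modular_dual Gdet hnu mf mg.
- have -> : b n m + a m n = A (- m) * B (- - m) + A n * B (- n).
    by rewrite opprK Am Bn An Bm mul1r mulr1.
  apply: (mean_lattice_two_terms w0 _ la lb) => [|t tm tn]; first by rewrite eq_sym.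
  rewrite (negPf tm) add0r eqr_opp (negPf tn) add0r.
  apply/eqP; apply: contraT; rewrite mulf_eq0 negb_or => /andP[/eqP at0 /eqP bt0].
  have [et nIt] : exponents G kk nu t /\ ~ index_set G kk nu U (- t).
    by apply: contrapT => /a0.
  have [et' nIt'] : exponents G (4 - kk) (conj_mult nu) (- t) /\
      ~ index_set G (4 - kk) (conj_mult nu) (cusps G `\` U) (- - t).
    by apply: contrapT => /b0.
  rewrite opprK in nIt'.
  by have [/nIt|/nIt'] := index_sets_cover G1 hU et et'.
- by move=> h Sh; exact: dual_product_other_cusps G1 ff gg Sh.
Qed.
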